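(* Let $\mathfrak{J},\mathfrak{M}$ be complex vector superspaces, let $\mathfrak{D}$ be a complex Lie superalgebra, and let $\mathfrak{g}=\mathfrak{sl}_2\otimes\mathfrak{J}\,\oplus\,V\otimes\mathfrak{M}\,\oplus\,\mathfrak{D}$, a vector superspace on which $\mathfrak{sl}_2$ acts through the first tensor factors and trivially on $\mathfrak{D}$ (so $\mathfrak{D}=\mathfrak{g}^{\mathfrak{sl}_2}$), with an even bilinear bracket $[-,-]$ extending the bracket of $\mathfrak{D}$. Then $\mathfrak{g}$ is a short $\mathfrak{sl}_2$-Lie superalgebra if and only if there exist even bilinear maps $\mathfrak{D}\otimes\mathfrak{J}\to\mathfrak{J}$, $\mathfrak{D}\otimes\mathfrak{M}\to\mathfrak{M}$ (both written $d\otimes\eta\mapsto d(\eta)$), super-symmetric even bilinear maps $\cdot:\mathfrak{J}\otimes\mathfrak{J}\to\mathfrak{J}$, $\bullet:\mathfrak{J}\otimes\mathfrak{M}\to\mathfrak{M}$, $\partial:\mathfrak{M}\otimes\mathfrak{M}\to\mathfrak{D}$ ($m\otimes n\mapsto\partial_{m,n}$) and super-antisymmetric even bilinear maps $\langle-,-\rangle:\mathfrak{J}\otimes\mathfrak{J}\to\mathfrak{D}$, $\star:\mathfrak{M}\otimes\mathfrak{M}\to\mathfrak{J}$ that describe the (super-anticommutative) bracket of $\mathfrak{g}$ by $$[d,x\otimes a]=x\otimes d(a),\qquad [d,v\otimes m]=v\otimes d(m),$$ $$[x\otimes a,y\otimes b]=[x,y]\otimes a\cdot b+\tfrac12\kappa(x,y)\langle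 a,b\rangle,\qquad [x\otimes a,v\otimes m]=x(v)\otimes a\bullet m,$$ $$[v\otimes m,w\otimes n]=(v\odot w)\otimes m\star n+\det(v,w)\,\partial_{m,n}$$ for $x,y\in\mathfrak{sl}_2$, $v,w\in V$, $a,b\in\mathfrak{J}$, $m,n\in\mathfrak{M}$, $d\in\mathfrak{D}$, and that satisfy the following conditions for all homogeneous $a,b,c\in\mathfrak{J}$, $m,n,r\in\mathfrak{M}$, $d,d_1,d_2\in\mathfrak{D}$, $\eta\in\mathfrak{J}\oplus\mathfrak{M}$: 1. $(\mathfrak{J},\cdot)$ is a Jordan superalgebra. 2. $\mathfrak{M}$ is a special Jordan $\mathfrak{J}$-supermodule with action $a\otimes m\mapsto a\bullet m$, that is, $(a\cdot b)\bullet m=\tfrac12\big(a\bullet(b\bullet m)+(-1)^{|a||b|}b\bullet(a\bullet m)\big)$. 3. $\mathfrak{D}$ super-derives the operations of $(\mathfrak{J}\oplus\mathfrak{M},\cdot,\bullet,\star)$, that is, $d(a\cdot b)=d(a)\cdot b+(-1)^{|d||a|}a\cdot d(b)$, $d(a\bullet m)=d(a)\bullet m+(-1)^{|d||a|}a\bullet d(m)$, $d(m\star n)=d(m)\star n+(-1)^{|d||m|}m\star d(n)$; and $[d_1,d_2](\eta)=d_1(d_2(\eta))-(-1)^{|d_1||d_2|}d_2(d_1(\eta))$. 4. The bilinear maps $\langle-,-\rangle$ and $\partial$ satisfy $$[d,\langle a,b\rangle]=\langle d(a),b\rangle+(-1)^{|d||a|}\langle a,d(b)\rangle,\qquad [d,\partial_{m,n}]=\partial_{d(m),n}+(-1)^{|d||m|}\partial_{m,d(n)},$$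 $$\langle a,b\rangle(c)=a\cdot(b\cdot c)-(-1)^{|a||b|}b\cdot(a\cdot c),\qquad 4\langle a,b\rangle(m)=a\bullet(b\bullet m)-(-1)^{|a||b|}b\bullet(a\bullet m),$$ $$\langle a\cdot b,c\rangle+(-1)^{|c|(|b|+|a|)}\langle c\cdot a,b\rangle+(-1)^{|a|(|c|+|b|)}\langle b\cdot c,a\rangle=0,$$ $$2\langle a,m\star n\rangle=-\partial_{a\bullet m,n}+(-1)^{|a||m|}\partial_{m,a\bullet n},$$ $$2\partial_{m,n}(a)=(-1)^{|a|(|m|+|n|)}(a\bullet m)\star n-(-1)^{|a||n|}m\star(a\bullet n),$$ $$\partial_{m,n}(r)+(-1)^{|m|(|n|+|r|)+|n||r|}\,\partial_{r,n}(m)=\tfrac12(m\star n)\bullet r+\tfrac12(-1)^{|m|(|n|+|r|)+|n||r|}(r\star n)\bullet m-(-1)^{|n||r|}(m\star r)\bullet n.$$ In particular, $\mathfrak{D}$ must act by inner derivations on the Jordan superalgebra $(\mathfrak{J},\cdot)$. 5. The following compatibility rule holds: $a\cdot(m\star n)=\tfrac12\big((a\bullet m)\star n+(-1)^{|a||m|}m\star(a\bullet n)\big)$.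
   Context: Everything is over $\mathbb{C}$; superspaces are $\mathbb{Z}_2$-graded, $|x|$ is the degree of a homogeneous element. $\mathfrak{sl}_2=\mathfrak{sl}_2(\mathbb{C})$ has standard basis $e,f,h$ with $[e,f]=h$, $[h,e]=2e$, $[h,f]=-2f$; $V=\mathbb{C}e_1\oplus\mathbb{C}e_2$ is its natural representation ($e e_2=e_1$, $f e_1=e_2$, $he_1=e_1$, $he_2=-e_2$, $ee_1=fe_2=0$). $\mathfrak{sl}_2$ and $V$ have even degree. $\kappa(x,y)=4\,\mathrm{tr}(xy)$ is the Killing form of $\mathfrak{sl}_2$; $\det:V\otimes V\to\mathbb{C}$ is the determinant form; $\odot:V\otimes V\to\mathfrak{sl}_2$ is the bilinear map with $e_1\odot e_1=e$, $e_1\odot e_2=e_2\odot e_1=-\tfrac12h$, $e_2\odot e_2=-f$. A Lie superalgebra is a superspace with an even bracket such that $[x,y]=-(-1)^{|x||y|}[y,x]$ and the super Jacobi identity $[x,[y,z]]=[[x,y],z]+(-1)^{|x||y|}[y,[x,z]]$ hold. An $\mathfrak{sl}_2$-Lie superalgebra is a Lie superalgebra on which $\mathfrak{sl}_2$ acts by even derivations; it is short if as $\mathfrak{sl}_2$-module it is of the form $\mathfrak{sl}_2\otimes\mathfrak{J}\oplus V\otimes\mathfrak{M}\oplus\mathfrak{D}$ with $\mathfrak{J},\mathfrak{M},\mathfrak{D}$ superspaces with trivial $\mathfrak{sl}_2$-action (so $\mathfrak{D}=\mathfrak{g}^{\mathfrak{sl}_2}$). Here the $\mathfrak{sl}_2$-action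 is the one given by the decomposition. A bilinear map $\beta$ is super-symmetric if $\beta(u,u')=(-1)^{|u||u'|}\beta(u',u)$ and super-antisymmetric if $\beta(u,u')=-(-1)^{|u||u'|}\beta(u',u)$. For $\bullet$, super-symmetry means the convention $m\bullet a:=(-1)^{|a||m|}a\bullet m$. A Jordan superalgebra is a superspace $\mathfrak{J}$ with an even product satisfying $a\cdot b=(-1)^{|a||b|}b\cdot a$ and $(a\cdot b)\cdot(c\cdot d)+(-1)^{|b||c|}(a\cdot c)\cdot(b\cdot d)+(-1)^{|b||d|+|c||d|}(a\cdot d)\cdot(b\cdot c)=((a\cdot b)\cdot c)\cdot d+(-1)^{|b||c|+|b||d|+|c||d|}((a\cdot d)\cdot c)\cdot b+(-1)^{|a||b|+|a||c|+|a||d|+|c||d|}((b\cdot d)\cdot c)\cdot a$ for homogeneous elements. The inner derivations of a Jordan superalgebra $\mathfrak{J}$ are the elements of the linear span in $\mathrm{End}(\mathfrak{J})$ of the maps $c\mapsto a\cdot(b\cdot c)-(-1)^{|a||b|}b\cdot(a\cdot c)$, with $a,b\in\mathfrak{J}$ homogeneous.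
   Formalization: In the last identity of condition 4 the signs of ∂_{r,n}(m), (r⋆n)•m and (m⋆r)•n are reversed (as printed it fails in sp(4)); ''D acts by inner derivations'' is stated only for the span of the ⟨a,b⟩ (false for all of D: J=C with zero product, M=0, D=C acting by scalars). *)

(* Defs.v *)
From mathcomp Require Import all_boot all_order all_algebra.
From mathcomp Require Import sesquilinear.
From mathcomp Require Export reals complex.

Set Implicit Arguments.
Unset Strict Implicit.
Unset Printing Implicit Defensive.

Import GRing.Theory.
Local Open Scope ring_scope.

(* Degrees in Z_2 are booleans (true = odd): addition is (+), and a product or
   sum of degrees in the exponent of a sign is computed in nat through the
   coercion bool >-> nat.  The vector 0 is homogeneous of both degrees. *)
Record superspace (K : fieldType) := Superspace {
  ss_sort :> lmodType K;
  homog : bool -> ss_sort -> Prop;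
  homog0 : forall p, homog p 0;
  homog_lin : forall p (c : K) u v,
    homog p u -> homog p v -> homog p (c *: u + v);
  homog_split : forall u, exists u0 u1,
    [/\ homog false u0, homog true u1 & u = u0 + u1];
  homog_direct : forall u, homog false u -> homog true u -> u = 0
}.

Section DirectSum.
Variables (K : fieldType) (U W : superspace K).

Definition dsum_homog (p : bool) (u : (U * W)%type) : Prop :=
  homog p u.1 /\ homog p u.2.

Lemma dsum_homog0 p : dsum_homog p 0.
Proof. by split; apply: homog0. Qed.

Lemma dsum_homog_lin p (c : K) u v :
  dsum_homog p u -> dsum_homog p v -> dsum_homog p (c *: u + v).
Proof. by move=> [? ?] [? ?]; split; apply: homog_lin. Qed.

Lemma dsum_homog_split u : exists u0 u1,
  [/\ dsum_homog false u0, dsum_homog true u1 & u = u0 + u1].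
Proof.
case: u => a b; have [a0 [a1 [? ? ->]]] := homog_split a.
by have [b0 [b1 [? ? ->]]] := homog_split b; exists (a0, b0), (a1, b1).
Qed.

Lemma dsum_homog_direct u : dsum_homog false u -> dsum_homog true u -> u = 0.
Proof.
case: u => a b [/= a0 b0] [/= a1 b1].
by rewrite (homog_direct a0 a1) (homog_direct b0 b1).
Qed.

Definition dsum : superspace K :=
  Superspace dsum_homog0 dsum_homog_lin dsum_homog_split dsum_homog_direct.

End DirectSum.

Definition even_bilinear (K : fieldType) (U W X : superspace K)
    (b : U -> W -> X) : Prop :=
  bilinear_for *:%R *:%R b /\
  forall p q u w, homog p u -> homog q w -> homog (p (+) q) (b u w).

Definition super_symmetric (K : fieldType) (U X : superspace K)
    (b : U -> U -> X) : Prop :=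
  forall p q u v, homog p u -> homog q v -> b u v = (-1) ^+ (p * q) *: b v u.

Definition super_antisymmetric (K : fieldType) (U X : superspace K)
    (b : U -> U -> X) : Prop :=
  forall p q u v, homog p u -> homog q v ->
    b u v = - ((-1) ^+ (p * q) *: b v u).

Definition super_jacobi (K : fieldType) (L : superspace K)
    (br : L -> L -> L) : Prop :=
  forall p q r x y z, homog p x -> homog q y -> homog r z ->
    br x (br y z) = br (br x y) z + (-1) ^+ (p * q) *: br y (br x z).

Definition lie_superalgebra (K : fieldType) (L : superspace K)
    (br : L -> L -> L) : Prop :=
  [/\ even_bilinear br, super_antisymmetric br & super_jacobi br].

(* sl_2 is the space of traceless 2 x 2 matrices and V = K e_1 + K e_2 is the
   space of column vectors of height 2, with action x *m v. *)
Section Sl2.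
Variable K : fieldType.
Implicit Types (x y : 'M[K]_2) (v w : 'cV[K]_2).

Definition sl2 : {pred 'M[K]_2} := [pred x | \tr x == 0].

Definition sl2_e : 'M[K]_2 := delta_mx ord0 ord_max.
Definition sl2_f : 'M[K]_2 := delta_mx ord_max ord0.
Definition sl2_h : 'M[K]_2 := delta_mx ord0 ord0 - delta_mx ord_max ord_max.
Definition e1 : 'cV[K]_2 := delta_mx ord0 ord0.
Definition e2 : 'cV[K]_2 := delta_mx ord_max ord0.

Definition sl2_br x y : 'M[K]_2 := x *m y - y *m x.
Definition killing x y : K := 4 * \tr (x *m y).
Definition det_form v w : K := \det (row_mx v w).

Definition odotV v w : 'M[K]_2 :=
  (v ord0 ord0 * w ord0 ord0) *: sl2_e
  - (2^-1 * (v ord0 ord0 * w ord_max ord0 + v ord_max ord0 * w ord0 ord0))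
      *: sl2_h
  - (v ord_max ord0 * w ord_max ord0) *: sl2_f.

End Sl2.

Arguments sl2 K : clear implicits.

Definition sl2_module (K : fieldType) (g : superspace K)
    (rho : 'M[K]_2 -> g -> g) : Prop :=
  [/\ {in sl2 K, forall x, linear (rho x)},
      {in sl2 K &, forall x y (c : K) u,
         rho (c *: x + y) u = c *: rho x u + rho y u} &
      {in sl2 K &, forall x y u,
         rho (sl2_br x y) u = rho x (rho y u) - rho y (rho x u)}].

Definition sl2_lie_superalgebra (K : fieldType) (g : superspace K)
    (br : g -> g -> g) (rho : 'M[K]_2 -> g -> g) : Prop :=
  [/\ lie_superalgebra br, sl2_module rho,
      {in sl2 K, forall x p u, homog p u -> homog p (rho x u)} &
      {in sl2 K, forall x u w, rho x (br u w) = br (rho x u) w + br u (rho x w)}].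

Section ShortForm.
Variables (K : fieldType) (J M D : superspace K).

(* Tensor products with sl_2 and V in coordinates: the triple (a, b, c) of
   sl2_tensor stands for e (x) a + f (x) b + h (x) c, and the pair (m, n) of
   V_tensor for e_1 (x) m + e_2 (x) n. *)
Definition sl2_tensor : superspace K := dsum (dsum J J) J.
Definition V_tensor : superspace K := dsum M M.
Definition short_form : superspace K := dsum (dsum sl2_tensor V_tensor) D.

Definition ptensJ (x : 'M[K]_2) (a : J) : sl2_tensor :=
  (x ord0 ord_max *: a, x ord_max ord0 *: a, x ord0 ord0 *: a).
Definition ptensM (v : 'cV[K]_2) (m : M) : V_tensor :=
  (v ord0 ord0 *: m, v ord_max ord0 *: m).

Definition inJ (x : 'M[K]_2) (a : J) : short_form := (ptensJ x a, 0, 0).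
Definition inM (v : 'cV[K]_2) (m : M) : short_form := (0, ptensM v m, 0).
Definition inD (d : D) : short_form := (0, 0, d).

Definition short_act (x : 'M[K]_2) (u : short_form) : short_form :=
  let: (a, b, c, (m, n), d) := u in
  (ptensJ (sl2_br x (sl2_e K)) a + ptensJ (sl2_br x (sl2_f K)) b
     + ptensJ (sl2_br x (sl2_h K)) c,
   ptensM (x *m e1 K) m + ptensM (x *m e2 K) n,
   0).

End ShortForm.

Arguments inJ {K J} M D x a.
Arguments inM {K} J {M} D v m.
Arguments inD {K} J M {D} d.

Definition short_sl2_lie_superalgebra (K : fieldType) (g : superspace K)
    (br : g -> g -> g) (rho : 'M[K]_2 -> g -> g) : Prop :=
  sl2_lie_superalgebra br rho /\
  exists (J M D : superspace K) (phi : g -> short_form J M D),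
    [/\ linear phi, bijective phi,
        forall p u, homog p u -> homog p (phi u) &
        {in sl2 K, forall x u, phi (rho x u) = short_act x (phi u)}].

Section Jordan.
Variables (K : fieldType) (J M : superspace K).
Variables (dot : J -> J -> J) (bul : J -> M -> M).

Definition jordan_superalgebra : Prop :=
  [/\ even_bilinear dot, super_symmetric dot &
    forall p q r s a b c d,
      homog p a -> homog q b -> homog r c -> homog s d ->
      dot (dot a b) (dot c d)
        + (-1) ^+ (q * r) *: dot (dot a c) (dot b d)
        + (-1) ^+ (q * s + r * s) *: dot (dot a d) (dot b c)
      = dot (dot (dot a b) c) d
        + (-1) ^+ (q * r + q * s + r * s) *: dot (dot (dot a d) c) b
        + (-1) ^+ (p * q + p * r + p * s + r * s) *: dot (dot (dot b d) c) a].

Definition special_jordan_supermodule : Prop :=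
  forall p q a b m, homog p a -> homog q b ->
    bul (dot a b) m
    = 2^-1 *: (bul a (bul b m) + (-1) ^+ (p * q) *: bul b (bul a m)).

Definition inner_derivation (F : J -> J) : Prop :=
  exists (n : nat) (k : 'I_n -> K) (p q : 'I_n -> bool) (a b : 'I_n -> J),
    (forall i, homog (p i) (a i) /\ homog (q i) (b i)) /\
    forall c, F c = \sum_(i < n) k i *:
      (dot (a i) (dot (b i) c) - (-1) ^+ (p i * q i) *: dot (b i) (dot (a i) c)).

End Jordan.

Section Structure.
Variables (K : fieldType) (J M D : superspace K).
Variable brD : D -> D -> D.
Variables (actJ : D -> J -> J) (actM : D -> M -> M).
Variables (dot : J -> J -> J) (bul : J -> M -> M) (par : M -> M -> D).
Variables (ang : J -> J -> D) (star : M -> M -> J).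

Definition describes_bracket
    (br : short_form J M D -> short_form J M D -> short_form J M D) : Prop :=
  super_antisymmetric br /\
  [/\ forall d, {in sl2 K, forall x a,
        br (inD J M d) (inJ M D x a) = inJ M D x (actJ d a)},
      forall d v m, br (inD J M d) (inM J D v m) = inM J D v (actM d m),
      {in sl2 K &, forall x y a b,
        br (inJ M D x a) (inJ M D y b)
        = inJ M D (sl2_br x y) (dot a b)
          + inD J M ((2^-1 * killing x y) *: ang a b)},
      {in sl2 K, forall x v a m,
        br (inJ M D x a) (inM J D v m) = inM J D (x *m v) (bul a m)} &
      forall v w m n,
        br (inM J D v m) (inM J D w n)
        = inJ M D (odotV v w) (star m n) + inD J M (det_form v w *: par m n)].

Definition super_derives : Prop :=
  [/\ forall s p d a b, homog s d -> homog p a ->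
        actJ d (dot a b)
        = dot (actJ d a) b + (-1) ^+ (s * p) *: dot a (actJ d b),
      forall s p d a m, homog s d -> homog p a ->
        actM d (bul a m)
        = bul (actJ d a) m + (-1) ^+ (s * p) *: bul a (actM d m) &
      forall s p d m n, homog s d -> homog p m ->
        actJ d (star m n)
        = star (actM d m) n + (-1) ^+ (s * p) *: star m (actM d n)].

Definition D_acts : Prop :=
  (forall s t d1 d2 a, homog s d1 -> homog t d2 ->
     actJ (brD d1 d2) a
     = actJ d1 (actJ d2 a) - (-1) ^+ (s * t) *: actJ d2 (actJ d1 a)) /\
  (forall s t d1 d2 m, homog s d1 -> homog t d2 ->
     actM (brD d1 d2) m
     = actM d1 (actM d2 m) - (-1) ^+ (s * t) *: actM d2 (actM d1 m)).

Definition D_equivariance : Prop :=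
  (forall s p d a b, homog s d -> homog p a ->
     brD d (ang a b)
     = ang (actJ d a) b + (-1) ^+ (s * p) *: ang a (actJ d b)) /\
  (forall s p d m n, homog s d -> homog p m ->
     brD d (par m n)
     = par (actM d m) n + (-1) ^+ (s * p) *: par m (actM d n)).

Definition ang_identities : Prop :=
  [/\ forall p q a b c, homog p a -> homog q b ->
        actJ (ang a b) c
        = dot a (dot b c) - (-1) ^+ (p * q) *: dot b (dot a c),
      forall p q a b m, homog p a -> homog q b ->
        4 *: actM (ang a b) m
        = bul a (bul b m) - (-1) ^+ (p * q) *: bul b (bul a m),
      forall p q r a b c, homog p a -> homog q b -> homog r c ->
        ang (dot a b) c
          + (-1) ^+ (r * (q + p)) *: ang (dot c a) b
          + (-1) ^+ (p * (r + q)) *: ang (dot b c) a = 0 &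
      forall p q a m n, homog p a -> homog q m ->
        2 *: ang a (star m n)
        = - par (bul a m) n + (-1) ^+ (p * q) *: par m (bul a n)].

(* The signs are those of the Jacobi identity on three elements of V (x) M; both
   sides change by -(-1)^{|m|(|n|+|r|)+|n||r|} when m and r are exchanged.  The
   variant with signs (+, +, -) instead of (-, -, +) in front of the terms
   par_{r,n}(m), (r * n)m and (m * r)n fails already in osp(1|2). *)
Definition par_identity : Prop :=
  forall p q r m n u, homog p m -> homog q n -> homog r u ->
    actM (par m n) u - (-1) ^+ (p * (q + r) + q * r) *: actM (par u n) m
    = 2^-1 *: bul (star m n) u
      - (2^-1 * (-1) ^+ (p * (q + r) + q * r)) *: bul (star u n) m
      + (-1) ^+ (q * r) *: bul (star m u) n.

Definition par_identities : Prop :=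
  (forall p q r a m n, homog p a -> homog q m -> homog r n ->
     2 *: actJ (par m n) a
     = (-1) ^+ (p * (q + r)) *: star (bul a m) n
       - (-1) ^+ (p * r) *: star m (bul a n)) /\
  par_identity.

(* The elements of D concerned are those of the span of ang: an arbitrary
   d : D may act on J by an outer derivation (for instance when dot = 0). *)
Definition acts_by_inner_derivations : Prop :=
  forall (n : nat) (k : 'I_n -> K) (a b : 'I_n -> J),
    inner_derivation dot (actJ (\sum_(i < n) k i *: ang (a i) (b i))).

Definition compatibility : Prop :=
  forall p q a m n, homog p a -> homog q m ->
    dot a (star m n)
    = 2^-1 *: (star (bul a m) n + (-1) ^+ (p * q) *: star m (bul a n)).

End Structure.

(* Main.v *)
Require Import Defs.
From mathcomp Require Import all_boot all_order all_algebra.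
From mathcomp Require Import ring.

Set Implicit Arguments.
Unset Strict Implicit.
Unset Printing Implicit Defensive.

Import GRing.Theory.
Local Open Scope ring_scope.

(** Write g for the space sl_2 (x) J + V (x) M + D.  Two facts make the theorem
    true, one on the shape of the bracket and one on the Jacobi identity; both
    hold over any field of characteristic zero.

    Shape.  If sl_2 acts by derivations, then for fixed a, b, m, n, d the
    brackets of pure tensors are equivariant maps from sl_2, V, sl_2 (x) sl_2,
    sl_2 (x) V or V (x) V to g, whose isotypic components are copies of sl_2, V
    and the trivial module.  The spaces of such maps are spanned by the bracket
    and the Killing form, by the action on V, and by the product odotV and the
    determinant, so that the bracket has the form described by the seven
    structure maps.  In place of complete reducibility, the lemmas br_DJ, br_DM,
    br_JM, br_MM and br_JJ locate the brackets of a few weight vectors by their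
    weight and obtain all the other brackets by applying e and f.

    Jacobi.  Call jacobiator of x, y, z the difference of the two sides of the
    super Jacobi identity.  For a bracket described by structure maps, the
    jacobiator of three pure tensors is a combination of a few equivariant
    expressions in the sl_2- and V-factors, such as (Killing form of x and y)
    times z, tensored with expressions in the structure maps, the defects, whose
    vanishing is one of the identities of the theorem (lemmas jacobiator_JJJ,
    jacobiator_JJM, jacobiator_JMM, jacobiator_MMM and those with D).  When the
    identities hold, all jacobiators of pure tensors vanish, hence all
    jacobiators (jacobi_of_identities).  Conversely the equivariant expressions
    are independent: evaluating them on well chosen vectors isolates each defect
    and gives back the identities (identities_of_jacobi).

    The Jordan identity is not a defect.  It follows from the two identities
    that the triple (J, J, J) yields: the cyclic identity for the form ang,
    acting on a fourth element of J through ang(a, b) = [L_a, L_b], is the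
    Jordan identity, up to super-commutativity (jordan_of_jacobi). *)

(** * Deciding linear identities in a vector space *)

(** A reified linear combination; LAtom i stands for the i-th entry of a list of
    vectors. *)
Inductive lin_expr (K : Type) : Type :=
  | LAtom of nat
  | LZero
  | LAdd of lin_expr K & lin_expr K
  | LOpp of lin_expr K
  | LScale of K & lin_expr K.
Arguments LAtom {K}.
Arguments LZero {K}.

Section LinExpr.
Variables (K : fieldType) (U : lmodType K).

Fixpoint lin_eval (env : seq U) (e : lin_expr K) : U :=
  match e with
  | LAtom i => nth 0 env i
  | LZero => 0
  | LAdd e1 e2 => lin_eval env e1 + lin_eval env e2
  | LOpp e1 => - lin_eval env e1
  | LScale c e1 => c *: lin_eval env e1
  end.

(** A coefficient None is a zero known from the shape of the expression, so that
    no field identity has to be decided for the atoms that do not occur. *)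
Definition add_coef (c c' : option K) : option K :=
  match c, c' with
  | None, _ => c'
  | _, None => c
  | Some k, Some k' => Some (k + k')
  end.

Fixpoint lin_coef (e : lin_expr K) (j : nat) : option K :=
  match e with
  | LAtom i => if eqn i j then Some 1 else None
  | LZero => None
  | LAdd e1 e2 => add_coef (lin_coef e1 j) (lin_coef e2 j)
  | LOpp e1 => omap -%R (lin_coef e1 j)
  | LScale c e1 => omap ( *%R c) (lin_coef e1 j)
  end.

Fixpoint same_coefs (e e' : lin_expr K) (n : nat) : Prop :=
  if n is m.+1 then
    same_coefs e e' m /\ odflt 0 (lin_coef e m) = odflt 0 (lin_coef e' m)
  else True.

Lemma lin_evalE env e :
  lin_eval env e = \sum_(j < size env) odflt 0 (lin_coef e j) *: env`_j.
Proof.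
have add_coefE c c' : odflt 0 (add_coef c c') = odflt 0 c + odflt 0 c'.
  by case: c c' => [k|] [k'|] //=; rewrite ?addr0 ?add0r.
elim: e => [i||e1 IH1 e2 IH2|e1 IH1|c e1 IH1] /=; rewrite ?IH1 ?IH2.
- have [lt_i|le_i] := ltnP i (size env).
    rewrite (bigD1 (Ordinal lt_i)) //= -[eqn i i]/(i == i) eqxx /= scale1r.
    rewrite big1 ?addr0 // => j ne_j; rewrite -[eqn i j]/(i == j) ifN /= ?scale0r //.
    by apply: contraNneq ne_j => eq_ij; apply/eqP/val_inj.
  rewrite nth_default // big1 // => j _; rewrite -[eqn i j]/(i == j) ifN /= ?scale0r //.
  by rewrite gtn_eqF // (leq_trans (ltn_ord j)).
- by rewrite big1 // => j _; rewrite scale0r.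
- by rewrite -big_split; apply: eq_bigr => j _; rewrite add_coefE scalerDl.
- rewrite -sumrN; apply: eq_bigr => j _.
  by case: (lin_coef e1 j) => [k|] /=; rewrite ?scale0r ?oppr0 ?scaleNr.
- rewrite scaler_sumr; apply: eq_bigr => j _.
  by case: (lin_coef e1 j) => [k|] /=; rewrite ?scale0r ?scaler0 ?scalerA.
Qed.

Lemma lin_eval_eq env e e' :
  same_coefs e e' (size env) -> lin_eval env e = lin_eval env e'.
Proof.
rewrite !lin_evalE; elim: (size env) => [|n IHn] /=; first by rewrite !big_ord0.
by case=> /IHn eq_n eq_c; rewrite !big_ord_recr /= eq_n eq_c.
Qed.

End LinExpr.

(** Atoms are compared up to unification and not syntactically: two occurrences of
    a vector may mention its module structure through different projections. *)
Ltac atom_index u env :=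
  match env with
  | ?w :: _ => let _ := match goal with _ => unify u w end in constr:(0%N)
  | _ :: ?env' => let i := atom_index u env' in constr:(i.+1)
  end.

Ltac add_atom u env :=
  match env with
  | _ => let _ := atom_index u env in env
  | _ => constr:(u :: env)
  end.

Ltac collect_atoms u env :=
  lazymatch u with
  | (?v + ?w)%R => let env' := collect_atoms v env in collect_atoms w env'
  | (- ?v)%R => collect_atoms v env
  | (_ *: ?v)%R => collect_atoms v env
  | 0%R => env
  | _ => add_atom u env
  end.

Ltac reify_lin K u env :=
  lazymatch u with
  | (?v + ?w)%R =>
      let e := reify_lin K v env in let e' := reify_lin K w env in
      constr:(@LAdd K e e')
  | (- ?v)%R => let e := reify_lin K v env in constr:(@LOpp K e)
  | (?c *: ?v)%R => let e := reify_lin K v env in constr:(@LScale K c e)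
  | 0%R => constr:(@LZero K)
  | _ => let i := atom_index u env in constr:(@LAtom K i)
  end.

(** The side conditions are all of the form n != 0 for a numeral n; they follow
    from the hypothesis that the characteristic is zero. *)
Ltac field_eq :=
  field; repeat (apply/andP; split);
  first [done | match goal with H : forall n, is_true (_ != 0) |- _ => exact: H end].

Ltac linear_eq K U :=
  lazymatch goal with
  | |- ?u = ?v =>
    let env := collect_atoms u (@nil U) in
    let env := collect_atoms v env in
    let e := reify_lin K u env in
    let e' := reify_lin K v env in
    refine (@lin_eval_eq K U env e e' _);
    cbv beta iota zeta delta
      [same_coefs lin_coef add_coef omap obind oapp odflt eqn size];
    repeat split; try reflexivity; field_eq
  end.

(** The component types of a direct sum of superspaces also occur in the type of an
    equation; unification selects the superspace whose carrier is that type. *)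
Ltac module_eq :=
  match goal with
  | |- @eq ?T _ _ =>
    match T with
    | context [@ss_sort ?K ?S] =>
      unify T (GRing.Lmodule.sort (@ss_sort K S)); linear_eq K (@ss_sort K S)
    end
  end.

(** * Superspaces and bilinear maps *)

Section Homogeneous.
Variables (K : fieldType) (U : superspace K).

Lemma homogD p (u v : U) : homog p u -> homog p v -> homog p (u + v).
Proof. by move=> hu hv; rewrite -[u]scale1r; apply: homog_lin. Qed.

Lemma homogZ p c (u : U) : homog p u -> homog p (c *: u).
Proof. by move=> hu; rewrite -[c *: u]addr0; apply/homog_lin/homog0. Qed.

End Homogeneous.

Section Bilinear.
Variables (K : fieldType) (U W X : lmodType K) (b : U -> W -> X).
Hypothesis bil_b : bilinear_for *:%R *:%R b.

Lemma bilDl u1 u2 w : b (u1 + u2) w = b u1 w + b u2 w.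
Proof. by have:= bil_b.1 w 1 u1 u2; rewrite /= !scale1r. Qed.
Lemma bilDr u w1 w2 : b u (w1 + w2) = b u w1 + b u w2.
Proof. by have:= bil_b.2 u 1 w1 w2; rewrite /= !scale1r. Qed.
Lemma bil0l w : b 0 w = 0.
Proof. by apply: (@addrI _ (b 0 w)); rewrite -bilDl !addr0. Qed.
Lemma bil0r u : b u 0 = 0.
Proof. by apply: (@addrI _ (b u 0)); rewrite -bilDr !addr0. Qed.
Lemma bilZl c u w : b (c *: u) w = c *: b u w.
Proof. by have:= bil_b.1 w c u 0; rewrite /= bil0l !addr0. Qed.
Lemma bilZr c u w : b u (c *: w) = c *: b u w.
Proof. by have:= bil_b.2 u c w 0; rewrite /= bil0r !addr0. Qed.
Lemma bilNl u w : b (- u) w = - b u w.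
Proof. by rewrite -scaleN1r bilZl scaleN1r. Qed.
Lemma bilNr u w : b u (- w) = - b u w.
Proof. by rewrite -scaleN1r bilZr scaleN1r. Qed.

Definition bilE := (bilDl, bilDr, bilZl, bilZr, bilNl, bilNr, bil0l, bil0r).

End Bilinear.

(** * Equivariant maps between sl_2 and V *)

Section Matrices.
Variable K : fieldType.
Hypothesis char0 : forall n, (n.+1%:R : K) != 0.
Implicit Types (x y z : 'M[K]_2) (u v w : 'cV[K]_2).

(** The scalar in front of <a, b> in the bracket of x (x) a and y (x) b. *)
Definition half_killing x y : K := 2^-1 * killing x y.

Lemma lift_ord2 : lift ord0 ord0 = ord_max :> 'I_2.
Proof. exact: val_inj. Qed.

Lemma mx2P m (A B : 'M[K]_(2, m)) :
  (forall j, A ord0 j = B ord0 j) -> (forall j, A ord_max j = B ord_max j) ->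
  A = B.
Proof.
move=> eq0 eq1; apply/matrixP=> i j.
by case: (unliftP ord0 i) => [i' ->|->]; rewrite // [i']ord1 lift_ord2.
Qed.

Lemma mulmx2E m n (A : 'M[K]_(m, 2)) (B : 'M[K]_(2, n)) i j :
  (A *m B) i j = A i ord0 * B ord0 j + A i ord_max * B ord_max j.
Proof. by rewrite mxE big_ord_recl big_ord1 lift_ord2. Qed.

Lemma tr2E x : \tr x = x ord0 ord0 + x ord_max ord_max.
Proof. by rewrite /mxtrace big_ord_recl big_ord1 lift_ord2. Qed.

Lemma det_formE v w :
  det_form v w = v ord0 ord0 * w ord_max ord0 - v ord_max ord0 * w ord0 ord0.
Proof.
have col0 i : row_mx v w i ord0 = v i ord0.
  by rewrite -[RHS](row_mxEl v w); congr (row_mx v w i _); apply: val_inj.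
have col1 i : row_mx v w i ord_max = w i ord0.
  by rewrite -[RHS](row_mxEr v w); congr (row_mx v w i _); apply: val_inj.
rewrite /det_form (expand_det_col _ ord0) big_ord_recl big_ord1 lift_ord2 !col0.
have lift1 : lift ord_max 0 = ord0 :> 'I_2 by apply: val_inj.
have minorE i : row' i (col' ord0 (row_mx v w)) 0 0 = w (lift i 0) ord0.
  by rewrite 2!mxE -col1; congr (row_mx v w _ _); apply: val_inj.
rewrite /cofactor !det_mx11 !minorE lift1.
have ->: lift ord0 0 = ord_max :> 'I_2 by apply: val_inj.
by rewrite /= expr0 expr1; ring.
Qed.

Lemma killing_def x y : killing x y = 4 * \tr (x *m y). Proof. by []. Qed.
Lemma sl2_br_def x y : sl2_br x y = x *m y - y *m x. Proof. by []. Qed.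
Lemma sl2_diag x : x \in sl2 K -> x ord_max ord_max = - x ord0 ord0.
Proof. by rewrite inE tr2E addrC addr_eq0 => /eqP. Qed.

Lemma sl2_br_in x y : sl2_br x y \in sl2 K.
Proof. by rewrite inE raddfB /= mxtrace_mulC subrr. Qed.

Lemma sl2E : ((sl2_e K \in sl2 K) * (sl2_f K \in sl2 K) * (sl2_h K \in sl2 K))%type.
Proof.
by do !split; rewrite inE tr2E !mxE /= ?subrr ?addr0 ?add0r ?subr0 ?sub0r ?addrN ?eqxx.
Qed.

Lemma sl2D x y : x \in sl2 K -> y \in sl2 K -> x + y \in sl2 K.
Proof. by rewrite !inE raddfD => /eqP/= -> /eqP ->; rewrite addr0. Qed.
Lemma sl2Z c x : x \in sl2 K -> c *: x \in sl2 K.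
Proof. by rewrite !inE mxtraceZ => /eqP ->; rewrite mulr0. Qed.
Lemma sl2N x : x \in sl2 K -> - x \in sl2 K.
Proof. by move=> /(sl2Z (-1)); rewrite scaleN1r. Qed.

Lemma odotV_in v w : odotV v w \in sl2 K.
Proof. by rewrite /odotV; do !apply: sl2D; do ?apply: sl2N; apply: sl2Z; rewrite sl2E. Qed.

Lemma addmxE m n (A B : 'M[K]_(m, n)) i j : (A + B) i j = A i j + B i j.
Proof. by rewrite mxE. Qed.
Lemma oppmxE m n (A : 'M[K]_(m, n)) i j : (- A) i j = - A i j.
Proof. by rewrite mxE. Qed.
Lemma scalemxE m n c (A : 'M[K]_(m, n)) i j : (c *: A) i j = c * A i j.
Proof. by rewrite mxE. Qed.
Lemma zeromxE m n i j : (0 : 'M[K]_(m, n)) i j = 0.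
Proof. by rewrite mxE. Qed.
Lemma deltamxE m n i' j' i j :
  (delta_mx i' j' : 'M[K]_(m, n)) i j = ((i == i') && (j == j'))%:R.
Proof. by rewrite mxE. Qed.

Lemma mx22P x y : x ord0 ord0 = y ord0 ord0 -> x ord0 ord_max = y ord0 ord_max ->
  x ord_max ord0 = y ord_max ord0 -> x ord_max ord_max = y ord_max ord_max -> x = y.
Proof.
by move=> eq00 eq01 eq10 eq11; apply: mx2P => j; case: (unliftP ord0 j) => [j' ->|->];
  rewrite ?[j']ord1 ?lift_ord2.
Qed.

Lemma cV2P v w : v ord0 ord0 = w ord0 ord0 -> v ord_max ord0 = w ord_max ord0 -> v = w.
Proof. by move=> eq0 eq1; apply: mx2P => j; rewrite [j]ord1. Qed.

Definition entryE := (mulmx2E, addmxE, oppmxE, scalemxE, zeromxE, deltamxE).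

Lemma odotVE v w :
  [/\ odotV v w ord0 ord0 = - 2^-1 * (v ord0 ord0 * w ord_max ord0 + v ord_max ord0 * w ord0 ord0),
      odotV v w ord0 ord_max = v ord0 ord0 * w ord0 ord0,
      odotV v w ord_max ord0 = - (v ord_max ord0 * w ord_max ord0) &
      odotV v w ord_max ord_max = 2^-1 * (v ord0 ord0 * w ord_max ord0 + v ord_max ord0 * w ord0 ord0)].
Proof.
split; rewrite /odotV /sl2_e /sl2_f /sl2_h;
  rewrite !entryE /=; field_eq.
Qed.

Ltac matrix_eq :=
  rewrite /half_killing /killing ?/sl2_br ?/sl2_e ?/sl2_f ?/sl2_h ?/e1 ?/e2;
  try (first [apply: mx22P | apply: cV2P]);
  rewrite ?(tr2E, det_formE);
  rewrite ?entryE /=;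
  repeat match goal with |- context [odotV ?v ?w] =>
    case: (odotVE v w); do 4 move=> -> end;
  repeat match goal with H : is_true (_ \in sl2 _) |- _ =>
    rewrite ?(sl2_diag H); clear H end;
  field_eq.

(** On sl_2 a double bracket is a combination of the two invariants built from the
    Killing form.  This is why the jacobiator of three elements of sl_2 (x) J
    splits along x, y and z. *)
Lemma sl2_br_br x y z : x \in sl2 K -> y \in sl2 K -> z \in sl2 K ->
  sl2_br x (sl2_br y z) = half_killing x y *: z - half_killing x z *: y.
Proof. move=> hx hy hz; matrix_eq. Qed.

Lemma half_killingC x y : half_killing x y = half_killing y x.
Proof. by rewrite /half_killing /killing mxtrace_mulC. Qed.

Lemma half_killing_br x y z :
  half_killing x (sl2_br y z) = - half_killing y (sl2_br x z).
Proof. matrix_eq. Qed.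

Lemma half_killing_brl x y z :
  half_killing (sl2_br x y) z = half_killing x (sl2_br y z).
Proof. by matrix_eq. Qed.

(** Traceless 2 x 2 matrices satisfy xy + yx = tr(xy), so the product xy on V is
    half the bracket plus half the trace. *)
Lemma mulmx_mulmx_sl2 x y v : x \in sl2 K -> y \in sl2 K ->
  x *m (y *m v) = 2^-1 *: (sl2_br x y *m v) + (4^-1 * half_killing x y) *: v.
Proof. move=> hx hy; matrix_eq. Qed.

Lemma odotVC v w : odotV v w = odotV w v.
Proof. matrix_eq. Qed.

Lemma det_formC v w : det_form v w = - det_form w v.
Proof. by rewrite !det_formE; ring. Qed.

(** The maps sl_2 (x) V (x) V -> sl_2 that occur in the jacobiators are combinations
    of [x, v . w], symmetric in v and w, and det(v, w) x, antisymmetric. *)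
Lemma odotV_mull x v w : x \in sl2 K ->
  odotV (x *m v) w = 2^-1 *: (sl2_br x (odotV v w) - det_form v w *: x).
Proof. move=> hx; matrix_eq. Qed.

Lemma odotV_mulr x v w : x \in sl2 K ->
  odotV v (x *m w) = 2^-1 *: (sl2_br x (odotV v w) + det_form v w *: x).
Proof. by move=> hx; rewrite odotVC odotV_mull // odotVC det_formC scaleNr opprK. Qed.

Lemma sl2_br_odotV x v w : x \in sl2 K ->
  sl2_br x (odotV v w) = odotV (x *m v) w + odotV v (x *m w).
Proof.
move=> hx; rewrite odotV_mull // odotV_mulr // -scalerDr addrACA addNr addr0.
by rewrite -mulr2n -scaler_nat scalerA mulVf ?scale1r //; apply: (char0 1).
Qed.

(** Invariant forms on sl_2 (x) V (x) V are unique up to a factor. *)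
Lemma det_mull x v w : x \in sl2 K ->
  det_form (x *m v) w = - 2^-1 * half_killing x (odotV v w).
Proof. move=> hx; matrix_eq. Qed.

Lemma det_mulr x v w : x \in sl2 K ->
  det_form v (x *m w) = 2^-1 * half_killing x (odotV v w).
Proof. move=> hx; matrix_eq. Qed.

(** The invariants V (x) V (x) V -> V form a space of dimension 2, in which
    det(u, v) w, det(v, w) u and det(u, w) v satisfy the relation
    det_form_plucker.  The two formulas express the same vector in two of the
    three possible bases, so that any one of the three can be avoided. *)
Lemma odotV_mul u v w :
  odotV u v *m w = 2^-1 *: (det_form u w *: v + det_form v w *: u).
Proof. matrix_eq. Qed.

Lemma odotV_mul_alt u v w :
  odotV u v *m w = (2^-1 * det_form u v) *: w + det_form v w *: u.
Proof. by matrix_eq. Qed.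

Lemma det_form_plucker u v w :
  det_form u w *: v = det_form u v *: w + det_form v w *: u.
Proof. matrix_eq. Qed.

Lemma sl2_coord x : x \in sl2 K ->
  x = x ord0 ord_max *: sl2_e K + x ord_max ord0 *: sl2_f K + x ord0 ord0 *: sl2_h K.
Proof. by move=> hx; matrix_eq. Qed.

Lemma cV2_coord v : v = v ord0 ord0 *: e1 K + v ord_max ord0 *: e2 K.
Proof. by matrix_eq. Qed.

Lemma sl2_br_self x : sl2_br x x = 0.
Proof. exact: subrr. Qed.

Lemma sl2_brC x y : sl2_br x y = - sl2_br y x.
Proof. by rewrite /sl2_br opprB. Qed.

Lemma sl2_brE :
  ((sl2_br (sl2_e K) (sl2_f K) = sl2_h K) * (sl2_br (sl2_e K) (sl2_h K) = (- 2) *: sl2_e K)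
   * (sl2_br (sl2_f K) (sl2_e K) = - sl2_h K) * (sl2_br (sl2_f K) (sl2_h K) = 2 *: sl2_f K)
   * (sl2_br (sl2_h K) (sl2_e K) = 2 *: sl2_e K) * (sl2_br (sl2_h K) (sl2_f K) = (- 2) *: sl2_f K)
   * (forall x, sl2_br x x = 0))%type.
Proof. by do !split=> *; rewrite ?sl2_br_self //; matrix_eq. Qed.

Lemma sl2_mulE :
  ((sl2_e K *m e1 K = 0) * (sl2_e K *m e2 K = e1 K) * (sl2_f K *m e1 K = e2 K)
   * (sl2_f K *m e2 K = 0) * (sl2_h K *m e1 K = e1 K) * (sl2_h K *m e2 K = - e2 K))%type.
Proof. by do !split; matrix_eq. Qed.

Lemma half_killingE :
  ((half_killing (sl2_e K) (sl2_f K) = 2) * (half_killing (sl2_e K) (sl2_h K) = 0)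
   * (half_killing (sl2_f K) (sl2_h K) = 0) * (half_killing (sl2_h K) (sl2_e K) = 0)
   * (half_killing (sl2_h K) (sl2_h K) = 4))%type.
Proof. by do !split; matrix_eq. Qed.

Lemma half_killingZr x k y : half_killing x (k *: y) = k * half_killing x y.
Proof. by rewrite /half_killing /killing -scalemxAr mxtraceZ; ring. Qed.

Lemma odotVE_basis :
  ((odotV (e2 K) (e2 K) = - sl2_f K) * (odotV (e1 K) (e2 K) = (- 2^-1) *: sl2_h K))%type.
Proof. by split; matrix_eq. Qed.

Lemma det_formE_basis :
  ((det_form (e1 K) (e2 K) = 1) * (det_form (e2 K) (e1 K) = - 1)
   * (forall v, det_form v v = 0))%type.
Proof. by do !split=> *; rewrite det_formE /e1 /e2 ?entryE /=; ring. Qed.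

Lemma sl2_brZr x k y : sl2_br x (k *: y) = k *: sl2_br x y.
Proof. by rewrite /sl2_br -scalemxAr -scalemxAl scalerBr. Qed.

Lemma sl2_br_brl x y z : sl2_br x (sl2_br y z) = sl2_br (sl2_br x y) z + sl2_br y (sl2_br x z).
Proof.
rewrite /sl2_br !(mulmxBl, mulmxBr) !mulmxA !opprB.
linear_eq K ('M[K]_2 : lmodType K).
Qed.

End Matrices.

(** * The space sl_2 (x) J + V (x) M + D as an sl_2-module *)

Definition even_linear (K : fieldType) (U W : superspace K) (f : U -> W) : Prop :=
  linear f /\ forall p u, homog p u -> homog p (f u).

Section ShortFormTheory.
Variables (K : fieldType) (J M D : superspace K).
Hypothesis char0 : forall n, (n.+1%:R : K) != 0.
Local Notation G := (short_form J M D).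
Local Notation iJ := (@inJ K J M D).
Local Notation iM := (@inM K J M D).
Local Notation iD := (@inD K J M D).
Implicit Types (x y z : 'M[K]_2) (v w : 'cV[K]_2) (a b c : J) (m n : M) (d : D).
Implicit Types u : G.

Lemma short_form_eq u u' :
    [/\ u.1.1.1.1 = u'.1.1.1.1, u.1.1.1.2 = u'.1.1.1.2 & u.1.1.2 = u'.1.1.2] ->
    u.1.2.1 = u'.1.2.1 /\ u.1.2.2 = u'.1.2.2 -> u.2 = u'.2 -> u = u'.
Proof.
by case: u u' => [[[[a b] c] [m n]] d] [[[[a' b'] c'] [m' n']] d'] /= [-> -> ->] [-> ->] ->.
Qed.

Lemma inJ_bilinear : bilinear_for *:%R *:%R (inJ M D : 'M[K]_2 -> J -> G).
Proof.
split=> [a k x y | x k a b]; apply: short_form_eq; rewrite /= ?mxE.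
all: do ?split; module_eq.
Qed.

Lemma inM_bilinear : bilinear_for *:%R *:%R (inM J D : 'cV[K]_2 -> M -> G).
Proof.
split=> [a k x y | x k a b]; apply: short_form_eq; rewrite /= ?mxE.
all: do ?split; module_eq.
Qed.

Lemma inD_linear (k : K) d d' : inD J M (k *: d + d') = k *: inD J M d + inD J M d'.
Proof. apply: short_form_eq => /=; do ?split; module_eq. Qed.

Lemma inDD d d' : iD (d + d') = iD d + iD d'.
Proof. by rewrite -[d]scale1r inD_linear !scale1r. Qed.
Lemma inD0 : iD 0 = 0. Proof. by []. Qed.
Lemma inDZ k d : iD (k *: d) = k *: iD d.
Proof. by rewrite -[k *: d]addr0 inD_linear inD0 addr0. Qed.
Lemma inDN d : iD (- d) = - iD d.
Proof. by rewrite -scaleN1r inDZ scaleN1r. Qed.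

Lemma inJDl x y a : iJ (x + y) a = iJ x a + iJ y a.
Proof. exact: bilDl inJ_bilinear _ _ _. Qed.
Lemma inMDl v w m : iM (v + w) m = iM v m + iM w m.
Proof. exact: bilDl inM_bilinear _ _ _. Qed.

(** Additivity in the matrix or vector argument is left out, because h and the
    brackets are sums by definition, and a rewrite would split them. *)
Definition in_linE :=
  (bilDr inJ_bilinear, bilZl inJ_bilinear, bilZr inJ_bilinear, bilNl inJ_bilinear,
   bilNr inJ_bilinear, bil0l inJ_bilinear, bil0r inJ_bilinear,
   bilDr inM_bilinear, bilZl inM_bilinear, bilZr inM_bilinear, bilNl inM_bilinear,
   bilNr inM_bilinear, bil0l inM_bilinear, bil0r inM_bilinear,
   inDD, inDZ, inDN, inD0).

Lemma short_form_coord u :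
  u = iJ (sl2_e K) u.1.1.1.1 + iJ (sl2_f K) u.1.1.1.2 + iJ (sl2_h K) u.1.1.2
      + (iM (e1 K) u.1.2.1 + iM (e2 K) u.1.2.2) + iD u.2.
Proof.
apply: short_form_eq => /=; rewrite /sl2_e /sl2_f /sl2_h /e1 /e2 ?entryE /=.
all: do ?split; module_eq.
Qed.

Lemma inJ_coord x a : x \in sl2 K ->
  iJ x a = x ord0 ord_max *: iJ (sl2_e K) a + x ord_max ord0 *: iJ (sl2_f K) a
           + x ord0 ord0 *: iJ (sl2_h K) a.
Proof. by move=> hx; rewrite {1}(sl2_coord hx) 2!(bilDl inJ_bilinear) !in_linE. Qed.

Lemma inM_coord v m :
  iM v m = v ord0 ord0 *: iM (e1 K) m + v ord_max ord0 *: iM (e2 K) m.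
Proof. by rewrite {1}(cV2_coord v) (bilDl inM_bilinear) !in_linE. Qed.

Lemma short_actE x u :
  short_act x u =
  ((x ord0 ord0 - x ord_max ord_max) *: u.1.1.1.1 - (2 * x ord0 ord_max) *: u.1.1.2,
   (x ord_max ord_max - x ord0 ord0) *: u.1.1.1.2 + (2 * x ord_max ord0) *: u.1.1.2,
   x ord0 ord_max *: u.1.1.1.2 - x ord_max ord0 *: u.1.1.1.1,
   (x ord0 ord0 *: u.1.2.1 + x ord0 ord_max *: u.1.2.2,
    x ord_max ord0 *: u.1.2.1 + x ord_max ord_max *: u.1.2.2), 0) :> G.
Proof.
case: u => [[[[a b] c] [m n]] d]; apply: short_form_eq => //=.
  by rewrite /sl2_br /sl2_e /sl2_f /sl2_h !entryE /=; split; module_eq.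
by rewrite /e1 /e2 !entryE /= !mulr0 !mulr1 !addr0 !add0r.
Qed.

Lemma short_act_linear x k u u' :
  short_act x (k *: u + u') = k *: short_act x u + short_act x u'.
Proof. by rewrite !short_actE; apply: short_form_eq => /=; do ?split; module_eq. Qed.

Lemma short_actD x u u' : short_act x (u + u') = short_act x u + short_act x u'.
Proof. by rewrite -[u]scale1r short_act_linear !scale1r. Qed.
Lemma short_act0 x : short_act x (0 : G) = 0.
Proof. by apply: (@addrI _ (short_act x 0)); rewrite -short_actD !addr0. Qed.
Lemma short_actZ x k u : short_act x (k *: u) = k *: short_act x u.
Proof. by rewrite -[k *: u]addr0 short_act_linear short_act0 addr0. Qed.
Lemma short_actN x u : short_act x (- u) = - short_act x u.
Proof. by rewrite -scaleN1r short_actZ scaleN1r. Qed.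

Lemma short_act_inJ x y a : y \in sl2 K ->
  short_act x (iJ y a) = iJ (sl2_br x y) a.
Proof.
move=> y_sl2; rewrite short_actE; apply: short_form_eq => /=; last by [].
  by rewrite /sl2_br !entryE (sl2_diag y_sl2) /=; split; module_eq.
by split; module_eq.
Qed.

Lemma short_act_inM x v m : short_act x (iM v m) = iM (x *m v) m.
Proof.
by rewrite short_actE; apply: short_form_eq => /=; rewrite ?entryE; do ?split; module_eq.
Qed.

Lemma short_act_inD x d : short_act x (iD d) = 0.
Proof. by rewrite short_actE; apply: short_form_eq => /=; do ?split; module_eq. Qed.

Lemma short_act_inl x y (k : K) u :
  short_act (k *: x + y) u = k *: short_act x u + short_act y u.
Proof.
rewrite !short_actE; apply: short_form_eq; rewrite /= ?entryE.
all: do ?split; module_eq.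
Qed.

Lemma homog_inJ p x a : homog p a -> homog p (iJ x a).
Proof. by move=> ha; do !split; do ?[exact: homogZ | exact: homog0]. Qed.
Lemma homog_inM p v m : homog p m -> homog p (iM v m).
Proof. by move=> hm; do !split; do ?[exact: homogZ | exact: homog0]. Qed.
Lemma homog_inD p d : homog p d -> homog p (iD d).
Proof. by move=> hd; do !split; do ?[exact: homogZ | exact: homog0]. Qed.

(** Multilinear identities on the whole space reduce to pure tensors. *)
Inductive pure (p : bool) : G -> Prop :=
  | PureJ x a of x \in sl2 K & homog p a : pure p (iJ x a)
  | PureM v m of homog p m : pure p (iM v m)
  | PureD d of homog p d : pure p (iD d).

Lemma pure_ind_add p (P : G -> Prop) :
    (forall u u', P u -> P u' -> P (u + u')) -> (forall u, pure p u -> P u) ->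
  forall u, homog p u -> P u.
Proof.
move=> PD Ppure u [[[[ha hb] hc] [hm hn]] hd].
rewrite (short_form_coord u).
apply: (PD); last by apply: Ppure; apply: PureD.
apply: (PD); last by apply: PD; apply: Ppure; apply: PureM.
by do ?apply: (PD); apply: Ppure; apply: PureJ; rewrite ?sl2E.
Qed.

Lemma pure_span (P : G -> Prop) :
    (forall u u', P u -> P u' -> P (u + u')) -> (forall p u, pure p u -> P u) ->
  forall u, P u.
Proof.
move=> PD Ppure u; have [u0 [u1 [h0 h1 ->]]] := homog_split u.
by apply: (PD); [apply: (pure_ind_add PD (Ppure false)) | apply: (pure_ind_add PD (Ppure true))].
Qed.

Lemma homog_short_act p x u : homog p u -> homog p (short_act x u).
Proof.
move: u; apply: pure_ind_add => [u u' | u]; first by rewrite short_actD; apply: homogD.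
by case=> [y a hy ha | v m hm | d hd]; rewrite ?short_act_inJ ?short_act_inM ?short_act_inD //;
  [apply: homog_inJ | apply: homog_inM | apply: homog0].
Qed.

Lemma short_act_br x y u :
  short_act (sl2_br x y) u = short_act x (short_act y u) - short_act y (short_act x u).
Proof.
move: u; apply: pure_span => [u u' Eu Eu' | p u].
  by rewrite !short_actD Eu Eu' opprD addrACA.
case=> [z a hz _ | v m _ | d _]; rewrite ?short_act_inJ ?short_act_inM ?short_act_inD ?sl2_br_in //.
- by rewrite sl2_br_brl inJDl addrK.
- by rewrite sl2_br_def mulmxBl -!mulmxA inMDl (bilNl inM_bilinear).
- by rewrite ?short_act0 subrr.
Qed.

Lemma sl2_module_short_act : sl2_module (@short_act K J M D).
Proof.
split=> [x _ k u u' | x y _ _ k u | x y _ _ u].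
- exact: short_act_linear.
- exact: short_act_inl.
- exact: short_act_br.
Qed.

(** The weights of h are 2, -2, 0 on sl_2, 1, -1 on V and 0 on D, so that each
    coordinate of an eigenvector is zero or has the eigenvalue as its weight. *)
Lemma short_act_weight (k : K) u : short_act (sl2_h K) u = k *: u ->
  [/\ (k - 2) *: u.1.1.1.1 = 0, (k + 2) *: u.1.1.1.2 = 0 & k *: u.1.1.2 = 0] /\
  [/\ (k - 1) *: u.1.2.1 = 0, (k + 1) *: u.1.2.2 = 0 & k *: u.2 = 0].
Proof.
rewrite short_actE /sl2_h !entryE => wu.
have := congr1 (fun w : G => w.1.1.1.1) wu.
have := congr1 (fun w : G => w.1.1.1.2) wu.
have := congr1 (fun w : G => w.1.1.2) wu.
have := congr1 (fun w : G => w.1.2.1) wu.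
have := congr1 (fun w : G => w.1.2.2) wu.
have := congr1 (fun w : G => w.2) wu.
rewrite /= => eD e2' e1' ec eb ea.
split; split.
- rewrite scalerBl -ea; module_eq.
- rewrite scalerDl -eb; module_eq.
- rewrite -ec; module_eq.
- rewrite scalerBl -e1'; module_eq.
- rewrite scalerDl -e2'; module_eq.
- by rewrite -eD.
Qed.

Lemma scale_eq0 (U : lmodType K) (k : K) (u : U) : k != 0 -> k *: u = 0 -> u = 0.
Proof. by move=> k0 /eqP; rewrite scaler_eq0 (negPf k0) => /eqP. Qed.

Lemma short_act_weight_ge3 (n : nat) u :
  short_act (sl2_h K) u = n.+3%:R *: u -> u = 0.
Proof.
have pos k : n.+3%:R + k%:R != 0 :> K by rewrite -natrD; apply: (char0 (n.+2 + k)).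
have pos2 : n.+3%:R - 2 != 0 :> K by rewrite -natrB //; apply: (char0 n).
have pos1 : n.+3%:R - 1 != 0 :> K by rewrite -(@natrB _ _ 1) //; apply: (char0 n.+1).
have pos0 : n.+3%:R != 0 :> K by apply: (char0 n.+2).
move=> /short_act_weight[[/(scale_eq0 pos2) ? /(scale_eq0 (pos 2)) ? /(scale_eq0 pos0) ?]].
move=> [/(scale_eq0 pos1) ? /(scale_eq0 (pos 1)) ? /(scale_eq0 pos0) ?].
by apply: short_form_eq.
Qed.

Lemma short_act_weight2 u :
  short_act (sl2_h K) u = 2 *: u -> u = iJ (sl2_e K) u.1.1.1.1.
Proof.
have two : (2 : K) != 0 := char0 1.
have four : 2 + 2 != 0 :> K by rewrite -natrD; apply: (char0 3).
have one : 2 - 1 != 0 :> K by rewrite -(@natrB _ 2 1) //; apply: (char0 0).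
have three : 2 + 1 != 0 :> K by rewrite -(@natrD _ 2 1); apply: (char0 2).
move=> /short_act_weight[[_ /(scale_eq0 four) b0 /(scale_eq0 two) c0]].
move=> [/(scale_eq0 one) m0 /(scale_eq0 three) n0 /(scale_eq0 two) d0].
by rewrite [LHS]short_form_coord b0 c0 m0 n0 d0 !in_linE !addr0.
Qed.

Lemma short_act_weight1 u :
  short_act (sl2_h K) u = u -> u = iM (e1 K) u.1.2.1.
Proof.
have one : 1 != 0 :> K := oner_neq0 K.
have two : 1 + 1 != 0 :> K := char0 1.
have neg : 1 - 2 != 0 :> K by rewrite -opprB oppr_eq0 -(@natrB _ 2 1).
have three : 1 + 2 != 0 :> K by rewrite -(@natrD _ 1 2); apply: (char0 2).
rewrite -[X in _ = X]scale1r => /short_act_weight[].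
move=> [/(scale_eq0 neg) a0 /(scale_eq0 three) b0 /(scale_eq0 one) c0].
move=> [_ /(scale_eq0 two) n0 /(scale_eq0 one) d0].
by rewrite [u in LHS]short_form_coord a0 b0 c0 n0 d0 !in_linE !addr0 add0r.
Qed.

Lemma short_act_weight0 u :
  short_act (sl2_h K) u = 0 -> u = iJ (sl2_h K) u.1.1.2 + iD u.2.
Proof.
have pos k : (0 : K) + k.+1%:R != 0 by rewrite add0r; apply: char0.
have neg k : (0 : K) - k.+1%:R != 0 by rewrite sub0r oppr_eq0; apply: char0.
rewrite -[X in _ = X](scale0r u) => /short_act_weight[].
move=> [/(scale_eq0 (neg 1)) a0 /(scale_eq0 (pos 1)) b0 _].
move=> [/(scale_eq0 (neg 0)) m0 /(scale_eq0 (pos 0)) n0 _].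
by rewrite [u in LHS]short_form_coord a0 b0 m0 n0 !in_linE !addr0 !add0r.
Qed.

Definition prE u : J := u.1.1.1.1.
Definition prH u : J := u.1.1.2.
Definition prV u : M := u.1.2.1.
Definition prD u : D := u.2.

Lemma prV_inM m : prV (iM (e1 K) m) = m.
Proof. by rewrite /prV /= /e1 !entryE /= scale1r. Qed.
Lemma prH_inJ_inD a d : prH (iJ (sl2_h K) a + iD d) = a.
Proof. by rewrite /prH /= /sl2_h !entryE /= subr0 scale1r addr0. Qed.
Lemma prD_inJ_inD x a d : prD (iJ x a + iD d) = d.
Proof. by rewrite /prD /= add0r. Qed.

Lemma even_linear_prE : even_linear prE.
Proof. by split=> // p u [[[[ha hb] hc] [hm hn]] hd]. Qed.
Lemma even_linear_prH : even_linear prH.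
Proof. by split=> // p u [[[[ha hb] hc] [hm hn]] hd]. Qed.
Lemma even_linear_prV : even_linear prV.
Proof. by split=> // p u [[[[ha hb] hc] [hm hn]] hd]. Qed.
Lemma even_linear_prD : even_linear prD.
Proof. by split=> // p u [[[[ha hb] hc] [hm hn]] hd]. Qed.

End ShortFormTheory.

(** * The shape of an equivariant bracket *)

(* From here on the coordinates of short_form stay hidden behind the lemmas above. *)
Opaque short_form inJ inM inD short_act prE prH prV prD.

Ltac short_eq :=
  match goal with
  | |- context [@short_form ?K ?J ?M ?D] => linear_eq K (@ss_sort K (@short_form K J M D))
  end.

(** Reduces a consequence of a linear equation to an identity without hypotheses, as
    module_eq decides them. *)
Lemma eq_scaled (K : fieldType) (U : lmodType K) (k : K) (u v u1 v1 : U) :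
  u1 = v1 -> u - v = k *: (u1 - v1) -> u = v.
Proof. by move=> ->; rewrite subrr scaler0 => /subr0_eq. Qed.

Section EquivariantBracket.
Variables (K : fieldType) (J M D : superspace K).
Hypothesis char0 : forall n, (n.+1%:R : K) != 0.
Local Notation G := (short_form J M D).
Local Notation iJ := (@inJ K J M D).
Local Notation iM := (@inM K J M D).
Local Notation iD := (@inD K J M D).
Local Notation e := (sl2_e K).
Local Notation f := (sl2_f K).
Local Notation h := (sl2_h K).
Variable br : G -> G -> G.
Hypothesis bil_br : bilinear_for *:%R *:%R br.
Hypothesis act_br : {in sl2 K, forall x u w,
  short_act x (br u w) = br (short_act x u) w + br u (short_act x w)}.

Let brE := bilE bil_br.

Lemma act_brE :
  ((forall u w, short_act e (br u w) = br (short_act e u) w + br u (short_act e w))%R *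
   (forall u w, short_act f (br u w) = br (short_act f u) w + br u (short_act f w))%R *
   (forall u w, short_act h (br u w) = br (short_act h u) w + br u (short_act h w))%R)%type.
Proof. by do !split=> *; apply: act_br; rewrite sl2E. Qed.

Ltac equivariance :=
  rewrite ?act_brE ?(short_act_inJ, short_act_inM, short_act_inD, short_actD,
    short_actZ, short_actN, short_act0) ?sl2E // ?(sl2_brE, sl2_mulE) ?(brE, in_linE).

(** The bracket of d with e (x) a has weight 2, hence is e (x) c; applying f twice
    gives the brackets with h (x) a and f (x) a. *)
Lemma br_DJ d a : {in sl2 K, forall x,
  br (iD d) (iJ x a) = iJ x (prE (br (iD d) (iJ e a)))}.
Proof.
move=> x hx; set c := prE _.
have Te : br (iD d) (iJ e a) = iJ e c.
  by apply: (short_act_weight2 char0); equivariance; rewrite add0r.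
have Th : br (iD d) (iJ h a) = iJ h c.
  have := congr1 (short_act f) Te; equivariance.
  by rewrite add0r => /oppr_inj.
have Tf : br (iD d) (iJ f a) = iJ f c.
  have := congr1 (short_act f) Th; equivariance.
  by rewrite add0r => /(scalerI (char0 1)).
by rewrite !(inJ_coord _ _ _ hx) !brE Te Tf Th.
Qed.

Lemma br_DM d v m : br (iD d) (iM v m) = iM v (prV (br (iD d) (iM (e1 K) m))).
Proof.
set c := prV _.
have T1 : br (iD d) (iM (e1 K) m) = iM (e1 K) c.
  by apply: (short_act_weight1 char0); equivariance; rewrite add0r.
have T2 : br (iD d) (iM (e2 K) m) = iM (e2 K) c.
  by have := congr1 (short_act f) T1; equivariance; rewrite add0r.
by rewrite !(inM_coord _ _ v) !brE T1 T2.
Qed.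

(** The bracket of e (x) a with e_1 (x) m has weight 3, so it vanishes: sl_2 (x) V has
    a copy of V, but its other summand does not occur in g.  Lowering this zero
    and the bracket of h (x) a with e_1 (x) m, of weight 1, gives all brackets. *)
Lemma br_JM v a m : {in sl2 K, forall x,
  br (iJ x a) (iM v m) = iM (x *m v) (prV (br (iJ h a) (iM (e1 K) m)))}.
Proof.
move=> x hx; set c := prV _.
have Te1 : br (iJ e a) (iM (e1 K) m) = 0.
  by apply: (@short_act_weight_ge3 _ _ _ _ char0 0); equivariance; short_eq.
have Th1 : br (iJ h a) (iM (e1 K) m) = iM (e1 K) c.
  by apply: (short_act_weight1 char0); equivariance; short_eq.
have Te2 : br (iJ e a) (iM (e2 K) m) = iM (e1 K) c.
  have := congr1 (short_act f) Te1; equivariance; rewrite Th1 => E.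
  by apply: (eq_scaled (k := 1)) E _; short_eq.
have Th2 : br (iJ h a) (iM (e2 K) m) = - iM (e2 K) c.
  have := congr1 (short_act f) Te2; equivariance => E.
  by apply: (eq_scaled (k := - 1)) E _; short_eq.
have Tf1 : br (iJ f a) (iM (e1 K) m) = iM (e2 K) c.
  have := congr1 (short_act f) Th1; equivariance; rewrite Th2 => E.
  by apply: (eq_scaled (k := 2^-1)) E _; short_eq.
have Tf2 : br (iJ f a) (iM (e2 K) m) = 0.
  have := congr1 (short_act f) Th2; equivariance => E.
  by apply: (eq_scaled (k := 2^-1)) E _; short_eq.
rewrite (inJ_coord _ _ _ hx) (inM_coord _ _ v) !brE Te1 Te2 Tf1 Tf2 Th1 Th2.
rewrite (inM_coord _ _ (x *m v)) !entryE (sl2_diag hx); short_eq.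
Qed.

(** V (x) V is the sum of sl_2 and the trivial module.  The bracket at (e_1, e_1) has
    weight 2 and determines the first component; the one at (e_1, e_2) has weight
    0 and contains the second. *)
Lemma br_MM v w m n :
  br (iM v m) (iM w n)
  = iJ (odotV v w) (prE (br (iM (e1 K) m) (iM (e1 K) n)))
    + iD (det_form v w *: prD (br (iM (e1 K) m) (iM (e2 K) n))).
Proof.
set c := prE _; set d := prD _.
have T11 : br (iM (e1 K) m) (iM (e1 K) n) = iJ e c.
  by apply: (short_act_weight2 char0); equivariance; short_eq.
have [c' T12] : exists c', br (iM (e1 K) m) (iM (e2 K) n) = iJ h c' + iD d.
  eexists; apply: (short_act_weight0 char0); equivariance; short_eq.
have {}T12 : br (iM (e1 K) m) (iM (e2 K) n) = (- 2^-1) *: iJ h c + iD d.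
  have Ec : - 2 *: iJ e c' = iJ e c.
    have := congr1 (short_act e) T12; equivariance; rewrite T11 => E.
    by apply: (eq_scaled (k := - 1)) E _; short_eq.
  have {Ec}/(congr1 (short_act f)) := Ec; equivariance => E.
  by rewrite T12; apply: (eq_scaled (k := 2^-1)) E _; short_eq.
have T21 : br (iM (e2 K) m) (iM (e1 K) n) = (- 2^-1) *: iJ h c - iD d.
  have := congr1 (short_act f) T11; equivariance; rewrite T12 => E.
  by apply: (eq_scaled (k := 1)) E _; short_eq.
have T22 : br (iM (e2 K) m) (iM (e2 K) n) = - iJ f c.
  have := congr1 (short_act f) T12; equivariance => E.
  by apply: (eq_scaled (k := 1)) E _; short_eq.
rewrite (inM_coord _ _ v) (inM_coord _ _ w) !brE T11 T12 T21 T22.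
rewrite (inJ_coord _ _ _ (@odotV_in _ v w)) in_linE det_formE.
by case: (odotVE char0 v w) => -> -> -> _; short_eq.
Qed.

(** The summand of dimension 5 of sl_2 (x) sl_2 is absent from g, which is seen on the
    bracket of weight 4 at (e, e).  The bracket at (e, f) has weight 0, and its
    two components determine all the others.  The factor 1/2 in front of its
    component in D comes from half_killing e f = 2. *)
Lemma br_JJ a b : {in sl2 K &, forall x y,
  br (iJ x a) (iJ y b)
  = iJ (sl2_br x y) (prH (br (iJ e a) (iJ f b)))
    + iD ((2^-1 * killing x y) *: (2^-1 *: prD (br (iJ e a) (iJ f b))))}.
Proof.
move=> x y hx hy; set c := prH _; set d := prD _.
have Tee : br (iJ e a) (iJ e b) = 0.
  by apply: (@short_act_weight_ge3 _ _ _ _ char0 1); equivariance; short_eq.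
have Tef : br (iJ e a) (iJ f b) = iJ h c + iD d.
  by apply: (short_act_weight0 char0); equivariance; short_eq.
have Teh : br (iJ e a) (iJ h b) = (- 2) *: iJ e c.
  have := congr1 (short_act e) Tef; equivariance => E.
  by apply: (eq_scaled (k := 1)) E _; short_eq.
have The : br (iJ h a) (iJ e b) = 2 *: iJ e c.
  have := congr1 (short_act f) Tee; equivariance; rewrite Teh => E.
  by apply: (eq_scaled (k := - 1)) E _; short_eq.
have Thf : br (iJ h a) (iJ f b) = (- 2) *: iJ f c.
  have := congr1 (short_act f) Tef; equivariance => E.
  by apply: (eq_scaled (k := - 1)) E _; short_eq.
have Thh : br (iJ h a) (iJ h b) = 2 *: iD d.
  have := congr1 (short_act f) Teh; equivariance; rewrite Tef => E.
  by apply: (eq_scaled (k := - 1)) E _; short_eq.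
have Tfe : br (iJ f a) (iJ e b) = iD d - iJ h c.
  have := congr1 (short_act f) The; equivariance; rewrite Thh => E.
  by apply: (eq_scaled (k := 2^-1)) E _; short_eq.
have Tff : br (iJ f a) (iJ f b) = 0.
  have := congr1 (short_act f) Thf; equivariance => E.
  by apply: (eq_scaled (k := 2^-1)) E _; short_eq.
have Tfh : br (iJ f a) (iJ h b) = 2 *: iJ f c.
  have := congr1 (short_act f) Thh; equivariance; rewrite Thf => E.
  by apply: (eq_scaled (k := 2^-1)) E _; short_eq.
rewrite (inJ_coord _ _ _ hx) (inJ_coord _ _ _ hy) !brE Tee Tef Teh Tfe Tff Tfh The Thf Thh.
rewrite (inJ_coord _ _ _ (sl2_br_in x y)) !in_linE killing_def tr2E !sl2_br_def !entryE.
rewrite (sl2_diag hx) (sl2_diag hy); short_eq.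
Qed.

End EquivariantBracket.

(** * The super Jacobi identity *)

Definition jacobiator (K : fieldType) (L : superspace K) (br : L -> L -> L)
    (p q : bool) (x y z : L) : L :=
  br x (br y z) - br (br x y) z - (-1) ^+ (p * q) *: br y (br x z).

Section SuperJacobi.
Variables (K : fieldType) (L : superspace K) (br : L -> L -> L).
Hypotheses (bil_br : even_bilinear br) (brC : super_antisymmetric br).

(** Exchanging neighbours multiplies the jacobiator by a sign, so that triples of
    tensors may be sorted before the identity is examined. *)
Lemma jacobiator_swap12 p q x y z : homog p x -> homog q y ->
  jacobiator br p q x y z = 0 -> jacobiator br q p y x z = 0.
Proof.
move=> hx hy E; apply: (eq_scaled (k := - (-1) ^+ (p * q))) E _.
rewrite /jacobiator (brC hy hx) !(bilE bil_br.1).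
by destruct p, q; rewrite /= ?(expr0, expr1); module_eq.
Qed.

Lemma jacobiator_swap23 p q r x y z : homog p x -> homog q y -> homog r z ->
  jacobiator br p q x y z = 0 -> jacobiator br p r x z y = 0.
Proof.
move=> hx hy hz E; apply: (eq_scaled (k := - (-1) ^+ (q * r))) E _.
rewrite /jacobiator (brC hz hy) (brC (bil_br.2 _ _ _ _ hx hz) hy).
rewrite (brC hz (bil_br.2 _ _ _ _ hx hy)) !(bilE bil_br.1).
by destruct p, q, r; rewrite /= ?(expr0, expr1); module_eq.
Qed.

(** The jacobiator is additive in z and its sign depends on x and y only, so that it
    vanishes at every z once it vanishes at the homogeneous ones. *)
Lemma super_jacobiP :
  super_jacobi br <->
  (forall p q x y z, homog p x -> homog q y -> jacobiator br p q x y z = 0).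
Proof.
split=> [jac p q x y z hx hy | jac p q r x y z hx hy _]; last first.
  by apply: (eq_scaled (k := 1)) (jac _ _ _ _ z hx hy) _; rewrite /jacobiator; module_eq.
have homog_jac r w : homog r w -> jacobiator br p q x y w = 0.
  by move=> hw; rewrite /jacobiator (jac _ _ _ _ _ _ hx hy hw); module_eq.
have [z0 [z1 [h0 h1 ->]]] := homog_split z.
rewrite -[RHS](addr0 0) -{1}(homog_jac _ _ h0) -(homog_jac _ _ h1).
by rewrite /jacobiator !(bilE bil_br.1); module_eq.
Qed.

End SuperJacobi.

(** * The jacobiators of pure tensors *)

Section Jacobiators.
Variables (K : fieldType) (J M D : superspace K).
Hypothesis char0 : forall n, (n.+1%:R : K) != 0.
Local Notation G := (short_form J M D).
Local Notation iJ := (@inJ K J M D).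
Local Notation iM := (@inM K J M D).
Local Notation iD := (@inD K J M D).
Local Notation t := half_killing.
Variables (br : G -> G -> G) (brD : D -> D -> D).
Variables (actJ : D -> J -> J) (actM : D -> M -> M).
Variables (dot : J -> J -> J) (bul : J -> M -> M) (par : M -> M -> D).
Variables (ang : J -> J -> D) (star : M -> M -> J).
Hypotheses (bil_br : even_bilinear br)
  (br_DD : forall d1 d2, br (iD d1) (iD d2) = iD (brD d1 d2))
  (bil_actJ : even_bilinear actJ) (bil_actM : even_bilinear actM)
  (bil_dot : even_bilinear dot) (bil_bul : even_bilinear bul)
  (bil_par : even_bilinear par) (bil_ang : even_bilinear ang)
  (bil_star : even_bilinear star)
  (dotC : super_symmetric dot) (parC : super_symmetric par)
  (angC : super_antisymmetric ang) (starC : super_antisymmetric star)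
  (br_desc : describes_bracket actJ actM dot bul par ang star br).
Implicit Types (a b c : J) (m n u : M) (d : D).

Local Notation brE := (bilE bil_br.1).
Local Notation mapE := (bilE bil_actJ.1, bilE bil_actM.1, bilE bil_dot.1,
  bilE bil_bul.1, bilE bil_par.1, bilE bil_ang.1, bilE bil_star.1).

Lemma br_inDJ d a : {in sl2 K, forall x, br (iD d) (iJ x a) = iJ x (actJ d a)}.
Proof. by case: br_desc => _ [H _ _ _ _] x hx; rewrite H. Qed.
Lemma br_inDM d v m : br (iD d) (iM v m) = iM v (actM d m).
Proof. by case: br_desc => _ [_ H _ _ _]; rewrite H. Qed.
Lemma br_inJJ a b : {in sl2 K &, forall x y,
  br (iJ x a) (iJ y b) = iJ (sl2_br x y) (dot a b) + t x y *: iD (ang a b)}.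
Proof. by case: br_desc => _ [_ _ H _ _] x y hx hy; rewrite H // inDZ. Qed.
Lemma br_inJM v a m : {in sl2 K, forall x,
  br (iJ x a) (iM v m) = iM (x *m v) (bul a m)}.
Proof. by case: br_desc => _ [_ _ _ H _] x hx; rewrite H. Qed.
Lemma br_inMM v w m n :
  br (iM v m) (iM w n) = iJ (odotV v w) (star m n) + det_form v w *: iD (par m n).
Proof. by case: br_desc => _ [_ _ _ _ H]; rewrite H inDZ. Qed.

Lemma br_inJD p s a d x : homog p a -> homog s d -> x \in sl2 K ->
  br (iJ x a) (iD d) = - ((-1) ^+ (p * s) *: iJ x (actJ d a)).
Proof.
move=> ha hd hx; rewrite -(br_inDJ d a hx).
by apply: br_desc.1; [apply: homog_inJ | apply: homog_inD].
Qed.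
Lemma br_inMD p s v m d : homog p m -> homog s d ->
  br (iM v m) (iD d) = - ((-1) ^+ (p * s) *: iM v (actM d m)).
Proof.
move=> hm hd; rewrite -(br_inDM d v m).
by apply: br_desc.1; [apply: homog_inM | apply: homog_inD].
Qed.
Lemma br_inMJ p q v m x a : homog p m -> homog q a -> x \in sl2 K ->
  br (iM v m) (iJ x a) = - ((-1) ^+ (p * q) *: iM (x *m v) (bul a m)).
Proof.
move=> hm ha hx; rewrite -(br_inJM v a m hx).
by apply: br_desc.1; [apply: homog_inM | apply: homog_inJ].
Qed.

(** Each defect is the difference of the two sides of one of the identities on the
    structure maps; p, q, r are the degrees of the arguments, in this order. *)
Definition innerJ_defect (p q : bool) a b c :=
  dot a (dot b c) - (-1) ^+ (p * q) *: dot b (dot a c) - actJ (ang a b) c.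
Definition ang_defect (p q r : bool) a b c :=
  ang (dot a b) c + (-1) ^+ (r * (q + p)) *: ang (dot c a) b
  + (-1) ^+ (p * (r + q)) *: ang (dot b c) a.
Definition innerM_defect (p q : bool) a b m :=
  bul a (bul b m) - (-1) ^+ (p * q) *: bul b (bul a m) - 4 *: actM (ang a b) m.
Definition special_defect (p q : bool) a b m :=
  2^-1 *: (bul a (bul b m) + (-1) ^+ (p * q) *: bul b (bul a m)) - bul (dot a b) m.
Definition star_defect (p q : bool) a m n :=
  dot a (star m n) - 2^-1 *: (star (bul a m) n + (-1) ^+ (p * q) *: star m (bul a n)).
Definition ang_star_defect (p q : bool) a m n :=
  2 *: ang a (star m n) + par (bul a m) n - (-1) ^+ (p * q) *: par m (bul a n).
Definition parJ_defect (p q r : bool) a m n :=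
  2 *: actJ (par m n) a - (-1) ^+ (p * (q + r)) *: star (bul a m) n
  + (-1) ^+ (p * r) *: star m (bul a n).
Definition parM_defect (p q r : bool) m n u :=
  actM (par m n) u - (-1) ^+ (p * (q + r) + q * r) *: actM (par u n) m
  - (2^-1 *: bul (star m n) u
      - (2^-1 * (-1) ^+ (p * (q + r) + q * r)) *: bul (star u n) m
      + (-1) ^+ (q * r) *: bul (star m u) n).

(** Once the degrees are known every sign is 1 or -1, and what remains is a linear
    identity. *)
Ltac signs := rewrite /= ?(expr0, expr1) ?(mapE, in_linE, brE); short_eq.

(** By sl2_br_br the component in sl_2 (x) J is a combination of x, y and z whose
    three coefficients are the same defect for permuted arguments; by invariance
    of the Killing form the component in D is a multiple of the single form
    (x, [y, z]). *)
Lemma jacobiator_JJJ p q r a b c x y z :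
    homog p a -> homog q b -> homog r c ->
    x \in sl2 K -> y \in sl2 K -> z \in sl2 K ->
  jacobiator br p q (iJ x a) (iJ y b) (iJ z c)
  = t x y *: iJ z (innerJ_defect p q a b c)
    - ((-1) ^+ (q * r) * t x z) *: iJ y (innerJ_defect p r a c b)
    + ((-1) ^+ (p * (q + r)) * t y z) *: iJ x (innerJ_defect q r b c a)
    - t x (sl2_br y z) *: iD (ang_defect p q r a b c).
Proof.
move=> ha hb hc hx hy hz.
have hxy := sl2_br_in x y; have hyz := sl2_br_in y z; have hxz := sl2_br_in x z.
rewrite /jacobiator /innerJ_defect /ang_defect !br_inJJ // !brE !br_inDJ // !br_inJJ //.
rewrite (br_inJD ha (bil_ang.2 _ _ _ _ hb hc) hx) (br_inJD hb (bil_ang.2 _ _ _ _ ha hc) hy).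
rewrite [sl2_br (sl2_br x y) z]sl2_brC !(sl2_br_br char0) // !(half_killingC z) (half_killingC y x).
rewrite (half_killing_brl char0) (half_killing_br char0 y x z).
rewrite (dotC hc hb) (dotC hc ha) (dotC hb ha) !mapE.
rewrite (dotC hc (bil_dot.2 _ _ _ _ ha hb)).
rewrite (angC (bil_dot.2 _ _ _ _ hb hc) ha) (angC (bil_dot.2 _ _ _ _ ha hc) hb).
rewrite !(inJDl, in_linE).
by destruct p, q, r; signs.
Qed.

(** The part of xy that is a bracket meets the special module identity, the scalar
    part the action of ang(a, b) on M. *)
Lemma jacobiator_JJM p q a b m x y v :
    homog p a -> homog q b -> x \in sl2 K -> y \in sl2 K ->
  jacobiator br p q (iJ x a) (iJ y b) (iM v m)
  = iM (sl2_br x y *m v) (special_defect p q a b m)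
    + (4^-1 * t x y) *: iM v (innerM_defect p q a b m).
Proof.
move=> ha hb hx hy; have hxy := sl2_br_in x y.
rewrite /jacobiator /special_defect /innerM_defect br_inJJ // !br_inJM // !brE.
rewrite br_inDM !br_inJM // !(mulmx_mulmx_sl2 char0) // [sl2_br y x]sl2_brC mulNmx.
rewrite (half_killingC y x) !(inMDl, in_linE).
by destruct p, q; signs.
Qed.

Lemma jacobiator_JMM p q r a m n x v w :
    homog p a -> homog q m -> homog r n -> x \in sl2 K ->
  jacobiator br p q (iJ x a) (iM v m) (iM w n)
  = iJ (sl2_br x (odotV v w)) (star_defect p q a m n)
    - (2^-1 * (-1) ^+ (p * (q + r)) * det_form v w) *: iJ x (parJ_defect p q r a m n)
    + (2^-1 * t x (odotV v w)) *: iD (ang_star_defect p q a m n).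
Proof.
move=> ha hm hn hx; have hvw := odotV_in v w.
rewrite /jacobiator /star_defect /parJ_defect /ang_star_defect.
rewrite !br_inJM // !br_inMM !brE br_inJJ // (br_inJD ha (bil_par.2 _ _ _ _ hm hn) hx).
rewrite (odotV_mull char0) // (odotV_mulr char0) // (det_mull char0) // (det_mulr char0) //.
move: (sl2_br x (odotV v w)) => z.
rewrite !(inJDl, in_linE).
by destruct p, q, r; signs.
Qed.

(** There are two independent invariants V (x) V (x) V -> V, hence two coefficients;
    they are the same defect for (m, n, u) and (n, m, u). *)
Lemma jacobiator_MMM p q r m n u v w z :
    homog p m -> homog q n -> homog r u ->
  jacobiator br p q (iM v m) (iM w n) (iM z u)
  = det_form w z *: iM v (parM_defect p q r m n u)
    - ((-1) ^+ (p * q) * det_form v z) *: iM w (parM_defect q p r n m u).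
Proof.
move=> hm hn hu.
rewrite /jacobiator /parM_defect !br_inMM !brE !br_inDM !br_inJM ?odotV_in //.
rewrite (br_inMJ v hm (bil_star.2 _ _ _ _ hn hu) (odotV_in _ _)).
rewrite (br_inMJ w hn (bil_star.2 _ _ _ _ hm hu) (odotV_in _ _)).
rewrite (br_inMD v hm (bil_par.2 _ _ _ _ hn hu)) (br_inMD w hn (bil_par.2 _ _ _ _ hm hu)).
(* The vectors v, w, z are linearly dependent; z is eliminated. *)
have plucker X : det_form v w *: iM z X = det_form v z *: iM w X - det_form w z *: iM v X.
  by rewrite -(bilZl (inM_bilinear J M D)) det_form_plucker inMDl (det_formC z w) !in_linE; short_eq.
rewrite plucker (odotV_mul char0 v w z) !(odotV_mul_alt char0).
rewrite (starC hu hn) (starC hu hm) (starC hn hm) (parC hu hn) (parC hu hm) (parC hn hm) !mapE.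
rewrite (det_formC z w) (det_formC z v) !(inMDl, in_linE).
by destruct p, q, r; signs.
Qed.

Lemma jacobiator_DJJ s p d a b x y : homog s d -> homog p a ->
    x \in sl2 K -> y \in sl2 K ->
  jacobiator br s p (iD d) (iJ x a) (iJ y b)
  = iJ (sl2_br x y)
      (actJ d (dot a b) - dot (actJ d a) b - (-1) ^+ (s * p) *: dot a (actJ d b))
    + t x y *: iD (brD d (ang a b) - ang (actJ d a) b - (-1) ^+ (s * p) *: ang a (actJ d b)).
Proof.
move=> hd ha hx hy; have hxy := sl2_br_in x y.
rewrite /jacobiator br_inJJ // !br_inDJ // !brE br_inDJ // br_DD !br_inJJ //.
by rewrite !in_linE; short_eq.
Qed.

Lemma jacobiator_DJM s p d a m x v : homog s d -> homog p a -> x \in sl2 K ->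
  jacobiator br s p (iD d) (iJ x a) (iM v m)
  = iM (x *m v)
      (actM d (bul a m) - bul (actJ d a) m - (-1) ^+ (s * p) *: bul a (actM d m)).
Proof.
move=> hd ha hx.
rewrite /jacobiator br_inJM // br_inDJ // !br_inDM !br_inJM //.
by rewrite !in_linE; short_eq.
Qed.

Lemma jacobiator_DMM s p d m n v w : homog s d -> homog p m ->
  jacobiator br s p (iD d) (iM v m) (iM w n)
  = iJ (odotV v w)
      (actJ d (star m n) - star (actM d m) n - (-1) ^+ (s * p) *: star m (actM d n))
    + det_form v w *: iD (brD d (par m n) - par (actM d m) n - (-1) ^+ (s * p) *: par m (actM d n)).
Proof.
move=> hd hm.
rewrite /jacobiator !br_inMM !brE br_DD br_inDJ ?odotV_in // !br_inDM !br_inMM.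
by rewrite !in_linE; short_eq.
Qed.

Lemma jacobiator_DDJ s p d d' a x : x \in sl2 K ->
  jacobiator br s p (iD d) (iD d') (iJ x a)
  = iJ x (actJ d (actJ d' a) - actJ (brD d d') a - (-1) ^+ (s * p) *: actJ d' (actJ d a)).
Proof.
by move=> hx; rewrite /jacobiator !(br_inDJ _ _ hx) br_DD !(br_inDJ _ _ hx) !in_linE; short_eq.
Qed.

Lemma jacobiator_DDM s p d d' m v :
  jacobiator br s p (iD d) (iD d') (iM v m)
  = iM v (actM d (actM d' m) - actM (brD d d') m - (-1) ^+ (s * p) *: actM d' (actM d m)).
Proof.
by rewrite /jacobiator !br_inDM br_DD !br_inDM !in_linE; short_eq.
Qed.

(** * From the Jacobi identity to the identities on the structure maps *)

Lemma inner_derivation_ext (F F' : J -> J) :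
  F =1 F' -> inner_derivation dot F -> inner_derivation dot F'.
Proof.
move=> eqF [n [k [p [q [a [b [hab FE]]]]]]].
by exists n, k, p, q, a, b; split=> // c; rewrite -eqF.
Qed.

Lemma inner_derivationD (F F' : J -> J) :
    inner_derivation dot F -> inner_derivation dot F' ->
  inner_derivation dot (fun c => F c + F' c).
Proof.
move=> [n [k [p [q [a [b [hab FE]]]]]]] [n' [k' [p' [q' [a' [b' [hab' FE']]]]]]].
(* The data of the two linear combinations are concatenated. *)
pose glue (T : Type) (g : 'I_n -> T) (g' : 'I_n' -> T) (i : 'I_(n + n')) :=
  match split i with inl j => g j | inr j => g' j end.
have glueL T g g' j : @glue T g g' (lshift n' j) = g j.
  by rewrite /glue; case: (split_ordP (lshift n' j)) => j' /eqP; rewrite ?eq_shift // => /eqP->.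
have glueR T g g' j : @glue T g g' (rshift n j) = g' j.
  by rewrite /glue; case: (split_ordP (rshift n j)) => j' /eqP; rewrite ?eq_shift // => /eqP->.
exists (n + n')%N, (glue _ k k'), (glue _ p p'), (glue _ q q'), (glue _ a a'), (glue _ b b').
split=> [i | c]; first by rewrite /glue; case: (split i).
by rewrite FE FE' big_split_ord; congr (_ + _); apply: eq_bigr => i _;
  rewrite ?glueL ?glueR.
Qed.

Lemma inner_derivationZ (k : K) (F : J -> J) :
  inner_derivation dot F -> inner_derivation dot (fun c => k *: F c).
Proof.
move=> [n [l [p [q [a [b [hab FE]]]]]]].
exists n, (fun i => k * l i), p, q, a, b; split=> // c.
by rewrite FE scaler_sumr; apply: eq_bigr => i _; rewrite scalerA.
Qed.

Lemma homog_ext (U X : superspace K) (F : U -> X) :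
    (forall w w', F (w + w') = F w + F w') -> (forall r w, homog r w -> F w = 0) ->
  forall w, F w = 0.
Proof.
move=> FD F0 w; have [w0 [w1 [h0 h1 ->]]] := homog_split w.
by rewrite FD (F0 _ _ h0) (F0 _ _ h1) addr0.
Qed.

Lemma inJ_inD_eq0 (k l : K) a d : k != 0 -> l != 0 ->
  k *: iJ (sl2_h K) a + l *: iD d = 0 -> a = 0 /\ d = 0.
Proof.
move=> k0 l0 E.
have {}E : iJ (sl2_h K) (k *: a) + iD (l *: d) = iJ (sl2_h K) 0 + iD 0.
  by rewrite !in_linE E addr0.
have := congr1 (@prH K J M D) E; rewrite !prH_inJ_inD => /(scale_eq0 k0) ->.
by have := congr1 (@prD K J M D) E; rewrite !prD_inJ_inD => /(scale_eq0 l0) ->.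
Qed.

Lemma inM_eq0 (k : K) m : k != 0 -> k *: iM (e1 K) m = 0 -> m = 0.
Proof.
move=> k0 /(scale_eq0 k0) E.
by rewrite -(prV_inM J D m) E -(bil0r (inM_bilinear J M D) (e1 K)) prV_inM.
Qed.

Definition structure_identities : Prop :=
  [/\ jordan_superalgebra dot,
      special_jordan_supermodule dot bul,
      super_derives actJ actM dot bul star /\ D_acts brD actJ actM,
      [/\ D_equivariance brD actJ actM par ang,
          ang_identities actJ actM dot bul par ang star,
          par_identities actJ actM bul par star &
          acts_by_inner_derivations actJ dot ang] &
      compatibility dot bul star].

Section FromJacobi.
Hypothesis jac : forall p q x y z, homog p x -> homog q y -> jacobiator br p q x y z = 0.
Local Notation h := (sl2_h K).
Local Notation f := (sl2_f K).
Local Notation e := (sl2_e K).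
Let he : e \in sl2 K. Proof. by rewrite sl2E. Qed.
Let hf : f \in sl2 K. Proof. by rewrite sl2E. Qed.
Let hh : h \in sl2 K. Proof. by rewrite sl2E. Qed.
Let nz1 : (1 : K) != 0. Proof. exact: (char0 0). Qed.
Let nz2 : (2 : K) != 0. Proof. exact: (char0 1). Qed.
Let nz4 : (4 : K) != 0. Proof. exact: (char0 3). Qed.
Let nzN (k : K) : k != 0 -> - k != 0. Proof. by rewrite oppr_eq0. Qed.

(** At (e, f, h) the elements e and f are orthogonal to h, so that only the term
    along z = h and the term in D survive. *)
Lemma innerJ_ang_defect0 p q r a b c : homog p a -> homog q b -> homog r c ->
  innerJ_defect p q a b c = 0 /\ ang_defect p q r a b c = 0.
Proof.
move=> ha hb hc; apply: (inJ_inD_eq0 nz2 (nzN nz4)).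
have <- := jac (iJ h c) (homog_inJ M D e ha) (homog_inJ M D f hb).
rewrite (jacobiator_JJJ ha hb hc) // sl2_brE half_killingZr !(half_killingE char0); short_eq.
Qed.

Lemma innerJ_defect0 p q a b c : homog p a -> homog q b -> innerJ_defect p q a b c = 0.
Proof.
move=> ha hb; move: c; apply: homog_ext => [c c' | r c hc].
  by rewrite /innerJ_defect !mapE; module_eq.
by case: (innerJ_ang_defect0 ha hb hc).
Qed.

(** At (h, h) the bracket vanishes and the Killing form does not. *)
Lemma innerM_defect0 p q a b m : homog p a -> homog q b -> innerM_defect p q a b m = 0.
Proof.
move=> ha hb; apply: (inM_eq0 nz1).
have <- := jac (iM (e1 K) m) (homog_inJ M D h ha) (homog_inJ M D h hb).
rewrite (jacobiator_JJM _ _ ha hb) // sl2_brE mul0mx (half_killingE char0) !in_linE; short_eq.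
Qed.

(** At (h, e) the Killing form vanishes and the bracket does not. *)
Lemma special_defect0 p q a b m : homog p a -> homog q b -> special_defect p q a b m = 0.
Proof.
move=> ha hb; apply: (inM_eq0 nz2).
have <- := jac (iM (e2 K) m) (homog_inJ M D h ha) (homog_inJ M D e hb).
rewrite (jacobiator_JJM _ _ ha hb) // sl2_brE (half_killingE char0) -scalemxAl sl2_mulE !in_linE; short_eq.
Qed.

(** At (e, e_2, e_2) the determinant vanishes. *)
Lemma star_ang_star_defect0 p q a m n : homog p a -> homog q m ->
  star_defect p q a m n = 0 /\ ang_star_defect p q a m n = 0.
Proof.
move=> ha hm; suff both r n' : homog r n' -> star_defect p q a m n' = 0 /\ ang_star_defect p q a m n' = 0.
  split; move: n; apply: homog_ext => [n n' | r n hn]; try by case: (both r n hn).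
    by rewrite /star_defect !mapE; module_eq.
  by rewrite /ang_star_defect !mapE; module_eq.
move=> hn; apply: (inJ_inD_eq0 (nzN nz1) (nzN nz1)).
have <- := jac (iM (e2 K) n') (homog_inJ M D e ha) (homog_inM J D (e2 K) hm).
rewrite (jacobiator_JMM _ _ ha hm hn) // (odotVE_basis char0) -[- f]scaleN1r.
rewrite half_killingZr (half_killingE char0) det_formE_basis.
rewrite sl2_brZr sl2_brE !in_linE; short_eq.
Qed.

(** At (h, e_1, e_2) the product e_1 . e_2 is proportional to h, whose bracket with h
    vanishes; the component in D is an instance of ang_star_defect. *)
Lemma parJ_defect0 p q r a m n : homog p a -> homog q m -> homog r n ->
  parJ_defect p q r a m n = 0.
Proof.
move=> ha hm hn.
have nzs1 : - (2^-1 * (-1) ^+ (p * (q + r))) != 0 :> K.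
  by rewrite oppr_eq0 mulf_neq0 ?invr_eq0 ?signr_eq0.
apply: (proj1 (inJ_inD_eq0 (d := 0) nzs1 nz1 _)).
have <- := jac (iM (e2 K) n) (homog_inJ M D h ha) (homog_inM J D (e1 K) hm).
rewrite (jacobiator_JMM _ _ ha hm hn) // (odotVE_basis char0).
rewrite half_killingZr (half_killingE char0) det_formE_basis.
case: (star_ang_star_defect0 n ha hm) => _ ->.
rewrite sl2_brZr sl2_brE !in_linE; short_eq.
Qed.

(** At (e_1, e_2, e_1) the coefficient det(v, z) of the other defect vanishes. *)
Lemma parM_defect0 p q r m n u : homog p m -> homog q n -> homog r u ->
  parM_defect p q r m n u = 0.
Proof.
move=> hm hn hu; apply: (inM_eq0 (nzN nz1)).
have <- := jac (iM (e1 K) u) (homog_inM J D (e1 K) hm) (homog_inM J D (e2 K) hn).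
rewrite (jacobiator_MMM _ _ _ hm hn hu) !det_formE_basis; short_eq.
Qed.

Lemma jacobi_DJJ s p d a b : homog s d -> homog p a ->
  actJ d (dot a b) - dot (actJ d a) b - (-1) ^+ (s * p) *: dot a (actJ d b) = 0 /\
  brD d (ang a b) - ang (actJ d a) b - (-1) ^+ (s * p) *: ang a (actJ d b) = 0.
Proof.
move=> hd ha; apply: (inJ_inD_eq0 nz1 nz2).
have <- := jac (iJ f b) (homog_inD J M hd) (homog_inJ M D e ha).
by rewrite (jacobiator_DJJ _ hd ha) // sl2_brE (half_killingE char0) scale1r.
Qed.

Lemma jacobi_DMM s p d m n : homog s d -> homog p m ->
  actJ d (star m n) - star (actM d m) n - (-1) ^+ (s * p) *: star m (actM d n) = 0 /\
  brD d (par m n) - par (actM d m) n - (-1) ^+ (s * p) *: par m (actM d n) = 0.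
Proof.
move=> hd hm.
have nzh : - 2^-1 != 0 :> K by rewrite oppr_eq0 invr_eq0.
apply: (inJ_inD_eq0 nzh nz1).
have <- := jac (iM (e2 K) n) (homog_inD J M hd) (homog_inM J D (e1 K) hm).
by rewrite (jacobiator_DMM _ _ _ hd hm) // (odotVE_basis char0) det_formE_basis !in_linE; short_eq.
Qed.

Lemma jacobi_DJM s p d a m : homog s d -> homog p a ->
  actM d (bul a m) - bul (actJ d a) m - (-1) ^+ (s * p) *: bul a (actM d m) = 0.
Proof.
move=> hd ha; apply: (inM_eq0 nz1).
have <- := jac (iM (e1 K) m) (homog_inD J M hd) (homog_inJ M D h ha).
by rewrite (jacobiator_DJM _ _ hd ha) // sl2_mulE scale1r.
Qed.

Lemma jacobi_DDJ s p d d' a : homog s d -> homog p d' ->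
  actJ d (actJ d' a) - actJ (brD d d') a - (-1) ^+ (s * p) *: actJ d' (actJ d a) = 0.
Proof.
move=> hd hd'; apply: (proj1 (inJ_inD_eq0 (d := 0) nz1 nz1 _)).
have <- := jac (iJ h a) (homog_inD J M hd) (homog_inD J M hd').
by rewrite jacobiator_DDJ // !in_linE; short_eq.
Qed.

Lemma jacobi_DDM s p d d' m : homog s d -> homog p d' ->
  actM d (actM d' m) - actM (brD d d') m - (-1) ^+ (s * p) *: actM d' (actM d m) = 0.
Proof.
move=> hd hd'; apply: (inM_eq0 nz1).
have <- := jac (iM (e1 K) m) (homog_inD J M hd) (homog_inD J M hd').
by rewrite jacobiator_DDM scale1r.
Qed.

(** Let the cyclic identity for (a, b, d) act on c.  Each term ang(a b, d) c is
    (a b)(d c) - d((a b) c), up to signs; the three first halves form one side of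
    the Jordan identity and the three second halves the other. *)
Lemma jordan_of_jacobi : jordan_superalgebra dot.
Proof.
split=> // p q r s a b c d ha hb hc hd.
have [_] := innerJ_ang_defect0 ha hb hd; rewrite /ang_defect => /(congr1 (actJ^~ c)) /=.
have ang_act p' q' a' b' : homog p' a' -> homog q' b' ->
    actJ (ang a' b') c = dot a' (dot b' c) - (-1) ^+ (p' * q') *: dot b' (dot a' c).
  by move=> ha' hb'; apply/esym/subr0_eq; apply: innerJ_defect0.
have hab := bil_dot.2 _ _ _ _ ha hb; have had := bil_dot.2 _ _ _ _ ha hd.
have hbd := bil_dot.2 _ _ _ _ hb hd.
rewrite (dotC hd ha) !mapE.
rewrite (ang_act _ _ _ _ hab hd) (ang_act _ _ _ _ had hb) (ang_act _ _ _ _ hbd ha).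
rewrite (dotC hd hc) !mapE.
rewrite (dotC hd (bil_dot.2 _ _ _ _ hab hc)) (dotC hb (bil_dot.2 _ _ _ _ had hc)).
rewrite (dotC ha (bil_dot.2 _ _ _ _ hbd hc)) (dotC hbd (bil_dot.2 _ _ _ _ ha hc)) => E.
apply: (eq_scaled (k := (-1) ^+ (r * s))) E _.
by destruct p, q, r, s; rewrite /= ?(expr0, expr1) ?mapE; module_eq.
Qed.

(** The definition of inner derivations asks for homogeneous elements, so a and b
    are split into their even and odd parts. *)
Lemma inner_derivation_ang a b : inner_derivation dot (actJ (ang a b)).
Proof.
have [a0 [a1 [ha0 ha1 ->]]] := homog_split a.
have [b0 [b1 [hb0 hb1 ->]]] := homog_split b.
have inner p q a' b' : homog p a' -> homog q b' -> inner_derivation dot (actJ (ang a' b')).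
  move=> ha' hb'; exists 1%N, (fun=> 1), (fun=> p), (fun=> q), (fun=> a'), (fun=> b').
  split=> // c; rewrite big_ord1 scale1r; apply/esym/subr0_eq; exact: innerJ_defect0.
pose sum4 c := (actJ (ang a0 b0) c + actJ (ang a0 b1) c) + (actJ (ang a1 b0) c + actJ (ang a1 b1) c).
have: inner_derivation dot sum4.
  by do !apply: inner_derivationD; [apply: (inner false false) | apply: (inner false true) |
    apply: (inner true false) | apply: (inner true true)].
by apply: inner_derivation_ext => c; rewrite /sum4 !mapE; module_eq.
Qed.

Lemma inner_of_jacobi : acts_by_inner_derivations actJ dot ang.
Proof.
move=> n k a b; elim: n k a b => [|n IHn] k a b.
  exists 0%N, (fun=> 0), (fun=> false), (fun=> false), (fun=> 0), (fun=> 0).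
  by split=> [[] | c] //; rewrite !big_ord0 !mapE.
have := inner_derivationD (inner_derivationZ (k ord0) (inner_derivation_ang (a ord0) (b ord0)))
  (IHn (fun i => k (lift ord0 i)) (fun i => a (lift ord0 i)) (fun i => b (lift ord0 i))).
by apply: inner_derivation_ext => c; rewrite big_ord_recl !mapE.
Qed.

Lemma identities_of_jacobi : structure_identities.
Proof.
split.
- exact: jordan_of_jacobi.
- by move=> p q a b m ha hb; apply/esym/subr0_eq; apply: special_defect0.
- split; split.
  + move=> s p d a b hd ha; apply: (eq_scaled (k := 1)) (proj1 (jacobi_DJJ b hd ha)) _; module_eq.
  + move=> s p d a m hd ha; apply: (eq_scaled (k := 1)) (jacobi_DJM m hd ha) _; module_eq.
  + move=> s p d m n hd hm; apply: (eq_scaled (k := 1)) (proj1 (jacobi_DMM n hd hm)) _; module_eq.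
  + move=> s p d d' a hd hd'; apply: (eq_scaled (k := - 1)) (jacobi_DDJ a hd hd') _; module_eq.
  + move=> s p d d' m hd hd'; apply: (eq_scaled (k := - 1)) (jacobi_DDM m hd hd') _; module_eq.
- split; [split | split | split | exact: inner_of_jacobi].
  + move=> s p d a b hd ha; apply: (eq_scaled (k := 1)) (proj2 (jacobi_DJJ b hd ha)) _; module_eq.
  + move=> s p d m n hd hm; apply: (eq_scaled (k := 1)) (proj2 (jacobi_DMM n hd hm)) _; module_eq.
  + by move=> p q a b c ha hb; apply/esym/subr0_eq; apply: innerJ_defect0.
  + by move=> p q a b m ha hb; apply/esym/subr0_eq; apply: innerM_defect0.
  + by move=> p q r a b c ha hb hc; case: (innerJ_ang_defect0 ha hb hc).
  + move=> p q a m n ha hm.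
    apply: (eq_scaled (k := 1)) (proj2 (star_ang_star_defect0 n ha hm)) _.
    by rewrite /ang_star_defect; module_eq.
  + move=> p q r a m n ha hm hn; apply: (eq_scaled (k := 1)) (parJ_defect0 ha hm hn) _.
    by rewrite /parJ_defect; module_eq.
  + by move=> p q r m n u hm hn hu; apply: subr0_eq; apply: parM_defect0.
- by move=> p q a m n ha hm; apply: subr0_eq; case: (star_ang_star_defect0 n ha hm).
Qed.

End FromJacobi.

(** * From the identities on the structure maps to the Jacobi identity *)

Lemma pure_homog p (g : G) : pure p g -> homog p g.
Proof. by case=> *; [apply: homog_inJ | apply: homog_inM | apply: homog_inD]. Qed.

Section ToJacobi.
Hypothesis jac_D : super_jacobi brD.
Hypothesis ids : structure_identities.

Lemma jacobi_of_identities : super_jacobi br.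
Proof.
case: ids => _ spec [[derJ derM derS] [repJ repM]].
case=> [[eqvA eqvP] [angJ angM angC3 angS] [parJ parM] _] compat.
have JJJ p q r a b c x y z : homog p a -> homog q b -> homog r c ->
    x \in sl2 K -> y \in sl2 K -> z \in sl2 K ->
    jacobiator br p q (iJ x a) (iJ y b) (iJ z c) = 0.
  move=> ha hb hc hx hy hz; rewrite (jacobiator_JJJ ha hb hc) //.
  rewrite /innerJ_defect (angJ _ _ _ _ _ ha hb) (angJ _ _ _ _ _ ha hc) (angJ _ _ _ _ _ hb hc).
  by rewrite /ang_defect (angC3 _ _ _ _ _ _ ha hb hc) !subrr !in_linE; short_eq.
have JJM p q r a b m x y v : homog p a -> homog q b -> homog r m ->
    x \in sl2 K -> y \in sl2 K -> jacobiator br p q (iJ x a) (iJ y b) (iM v m) = 0.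
  move=> ha hb _ hx hy; rewrite (jacobiator_JJM _ _ ha hb) //.
  rewrite /special_defect /innerM_defect (spec _ _ _ _ _ ha hb) (angM _ _ _ _ _ ha hb).
  by rewrite !subrr !in_linE; short_eq.
have JMM p q r a m n x v w : homog p a -> homog q m -> homog r n ->
    x \in sl2 K -> jacobiator br p q (iJ x a) (iM v m) (iM w n) = 0.
  move=> ha hm hn hx; rewrite (jacobiator_JMM _ _ ha hm hn) //.
  have ->: star_defect p q a m n = 0 by rewrite /star_defect (compat _ _ _ _ _ ha hm) subrr.
  have ->: parJ_defect p q r a m n = 0.
    by rewrite /parJ_defect (parJ _ _ _ _ _ _ ha hm hn); module_eq.
  have ->: ang_star_defect p q a m n = 0.
    by rewrite /ang_star_defect (angS _ _ _ _ _ ha hm); module_eq.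
  by rewrite !in_linE; short_eq.
have MMM p q r m n u v w z : homog p m -> homog q n -> homog r u ->
    jacobiator br p q (iM v m) (iM w n) (iM z u) = 0.
  have parM0 p' q' r' m' n' u' : homog p' m' -> homog q' n' -> homog r' u' ->
      parM_defect p' q' r' m' n' u' = 0.
    by move=> hm hn hu; rewrite /parM_defect (parM _ _ _ _ _ _ hm hn hu) subrr.
  move=> hm hn hu; rewrite (jacobiator_MMM _ _ _ hm hn hu) !(parM0 _ _ _ _ _ _ _ _ hu) //.
  by rewrite !in_linE; short_eq.
have DJJ s p r d a b x y : homog s d -> homog p a -> homog r b ->
    x \in sl2 K -> y \in sl2 K -> jacobiator br s p (iD d) (iJ x a) (iJ y b) = 0.
  move=> hd ha _ hx hy; rewrite (jacobiator_DJJ _ hd ha) // (derJ _ _ _ _ _ hd ha) (eqvA _ _ _ _ _ hd ha).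
  by rewrite !in_linE; short_eq.
have DJM s p r d a m x v : homog s d -> homog p a -> homog r m ->
    x \in sl2 K -> jacobiator br s p (iD d) (iJ x a) (iM v m) = 0.
  move=> hd ha _ hx; rewrite (jacobiator_DJM _ _ hd ha) // (derM _ _ _ _ _ hd ha).
  by rewrite !in_linE; short_eq.
have DMM s p r d m n v w : homog s d -> homog p m -> homog r n ->
    jacobiator br s p (iD d) (iM v m) (iM w n) = 0.
  move=> hd hm _; rewrite (jacobiator_DMM _ _ _ hd hm) // (derS _ _ _ _ _ hd hm) (eqvP _ _ _ _ _ hd hm).
  by rewrite !in_linE; short_eq.
have DDJ s p r d d' a x : homog s d -> homog p d' -> homog r a ->
    x \in sl2 K -> jacobiator br s p (iD d) (iD d') (iJ x a) = 0.
  move=> hd hd' _ hx; rewrite jacobiator_DDJ // (repJ _ _ _ _ _ hd hd').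
  by rewrite !in_linE; short_eq.
have DDM s p r d d' m v : homog s d -> homog p d' -> homog r m ->
    jacobiator br s p (iD d) (iD d') (iM v m) = 0.
  move=> hd hd' _; rewrite jacobiator_DDM // (repM _ _ _ _ _ hd hd').
  by rewrite !in_linE; short_eq.
have DDD s p r d d' d'' : homog s d -> homog p d' -> homog r d'' ->
    jacobiator br s p (iD d) (iD d') (iD d'') = 0.
  move=> hd hd' hd''; rewrite /jacobiator !br_DD (jac_D hd hd' hd'') !in_linE; short_eq.
have pure_jac p q r g1 g2 g3 : pure p g1 -> pure q g2 -> pure r g3 ->
    jacobiator br p q g1 g2 g3 = 0.
  move=> h1 h2 h3.
  have [hg1 hg2 hg3] := And3 (pure_homog h1) (pure_homog h2) (pure_homog h3).
  have swap12 := jacobiator_swap12 bil_br br_desc.1.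
  have swap23 := jacobiator_swap23 bil_br br_desc.1.
  have s213 := swap12 _ _ _ _ g3 hg2 hg1.
  have s132 := swap23 _ _ _ _ _ _ hg1 hg3 hg2.
  have s231 E := s213 (swap23 _ _ _ _ _ _ hg2 hg3 hg1 E).
  have s312 E := s132 (swap12 _ _ _ _ g2 hg3 hg1 E).
  have s321 E := s231 (swap12 _ _ _ _ g1 hg3 hg2 E).
  (* Every triple is sorted so that D comes first, then J, then M. *)
  move: s213 s132 s231 s312 s321; clear hg1 hg2 hg3 swap12 swap23.
  case: h1 => [x a hx ha | v m hm | d hd]; case: h2 => [y b hy hb | w n hn | d' hd'];
    case: h3 => [z c hz hc | v' u hu | d'' hd'']; move=> s213 s132 s231 s312 s321.
  - exact: (JJJ p q r).
  - exact: (JJM p q r).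
  - by apply: s312; apply: (DJJ r p q).
  - by apply: s132; apply: (JJM p r q).
  - exact: (JMM p q r).
  - by apply: s312; apply: (DJM r p q).
  - by apply: s213; apply: (DJJ q p r).
  - by apply: s213; apply: (DJM q p r).
  - by apply: s231; apply: (DDJ q r p).
  - by apply: s231; apply: (JJM q r p).
  - by apply: s213; apply: (JMM q p r).
  - by apply: s321; apply: (DJM r q p).
  - by apply: s312; apply: (JMM r p q).
  - exact: (MMM p q r).
  - by apply: s312; apply: (DMM r p q).
  - by apply: s231; apply: (DJM q r p).
  - by apply: s213; apply: (DMM q p r).
  - by apply: s231; apply: (DDM q r p).
  - exact: (DJJ p q r).
  - exact: (DJM p q r).
  - by apply: s132; apply: (DDJ p r q).
  - by apply: s132; apply: (DJM p r q).
  - exact: (DMM p q r).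
  - by apply: s132; apply: (DDM p r q).
  - exact: (DDJ p q r).
  - exact: (DDM p q r).
  - exact: (DDD p q r).
move=> p q r g1 g2 g3 h1 h2 h3.
suff jac0: jacobiator br p q g1 g2 g3 = 0.
  by apply: (eq_scaled (k := 1)) jac0 _; rewrite /jacobiator; short_eq.
move: g1 h1; apply: pure_ind_add => [g g' jac_g jac_g' | g1 h1].
  by rewrite -(addr0 0) -{1}jac_g -jac_g' /jacobiator !brE; short_eq.
move: g2 h2; apply: pure_ind_add => [g g' jac_g jac_g' | g2 h2].
  by rewrite -(addr0 0) -{1}jac_g -jac_g' /jacobiator !brE; short_eq.
move: g3 h3; apply: pure_ind_add => [g g' jac_g jac_g' | g3 h3].
  by rewrite -(addr0 0) -{1}jac_g -jac_g' /jacobiator !brE; short_eq.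
exact: pure_jac h1 h2 h3.
Qed.

End ToJacobi.

(** The bracket is assembled from equivariant maps. *)
Lemma short_act_derivation : {in sl2 K, forall x (g g' : G),
  short_act x (br g g') = br (short_act x g) g' + br g (short_act x g')}.
Proof.
move=> x hx; apply: pure_span => [g1 g2 d1 d2 g' | p g pg].
  by rewrite short_actD !brE short_actD d1 d2; short_eq.
apply: pure_span => [g1 g2 d1 d2 | q g' pg'].
  by rewrite short_actD !brE short_actD d1 d2; short_eq.
have inbr y : sl2_br x y \in sl2 K := sl2_br_in x y.
case: pg => [y a hy ha | v m hm | d hd]; case: pg' => [z b hz hb | w n hn | d' hd'].
- rewrite br_inJJ // short_actD short_actZ !short_act_inJ ?sl2_br_in // short_act_inD.
  rewrite !br_inJJ // sl2_br_brl inJDl (half_killing_br char0 y x z) (half_killing_brl char0).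
  short_eq.
- rewrite br_inJM // !short_act_inM short_act_inJ // !br_inJM // -inMDl.
  by rewrite sl2_br_def mulmxBl -!mulmxA subrK.
- rewrite (br_inJD ha hd' hy) short_actN short_actZ !short_act_inJ // short_act_inD.
  by rewrite (br_inJD ha hd' (inbr y)) brE addr0.
- rewrite (br_inMJ _ hm hb hz) short_actN short_actZ !short_act_inM short_act_inJ //.
  rewrite (br_inMJ _ hm hb hz) (br_inMJ _ hm hb (inbr z)) sl2_br_def mulmxBl -!mulmxA inMDl !in_linE.
  short_eq.
- rewrite br_inMM short_actD short_actZ !short_act_inM short_act_inD short_act_inJ ?odotV_in //.
  rewrite !br_inMM (sl2_br_odotV char0) // (det_mull char0) // (det_mulr char0) // inJDl; short_eq.
- rewrite (br_inMD _ hm hd') short_actN short_actZ !short_act_inM short_act_inD.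
  by rewrite (br_inMD _ hm hd') brE addr0.
- by rewrite br_inDJ // !short_act_inJ // short_act_inD brE br_inDJ // add0r.
- by rewrite br_inDM !short_act_inM short_act_inD brE br_inDM add0r.
- by rewrite br_DD !short_act_inD !brE addr0.
Qed.

Lemma short_of_identities : super_jacobi brD -> structure_identities ->
  short_sl2_lie_superalgebra br (@short_act K J M D).
Proof.
move=> jac_D ids; split.
  split.
  - by split=> //; [exact: br_desc.1 | exact: jacobi_of_identities].
  - exact: sl2_module_short_act.
  - by move=> x _ p g; apply: homog_short_act.
  - exact: short_act_derivation.
by exists J, M, D, id; split=> //; exists id.
Qed.

End Jacobiators.

(** * The structure maps of a short sl_2-Lie superalgebra *)

Section Maps.
Variables (K : fieldType) (J M D : superspace K).
Hypothesis char0 : forall n, (n.+1%:R : K) != 0.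
Local Notation G := (short_form J M D).
Local Notation iJ := (@inJ K J M D).
Local Notation iM := (@inM K J M D).
Local Notation iD := (@inD K J M D).

Lemma even_bilinear_comp (U W X : superspace K) (br : G -> G -> G)
    (i : U -> G) (i' : W -> G) (pr : G -> X) :
    even_bilinear br -> even_linear i -> even_linear i' -> even_linear pr ->
  even_bilinear (fun u w => pr (br (i u) (i' w))).
Proof.
move=> [bil_br even_br] [lin_i even_i] [lin_i' even_i'] [lin_pr even_pr].
split; last by move=> p q u w hu hw; apply/even_pr/even_br; [apply: even_i | apply: even_i'].
by split=> [w k u u' | u k w w'] /=; rewrite ?lin_i ?lin_i' !(bilE bil_br) lin_pr.
Qed.

Lemma even_linear_inJ x : even_linear (iJ x).
Proof. by split=> [k a b | p a]; [rewrite !in_linE | apply: homog_inJ]. Qed.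
Lemma even_linear_inM v : even_linear (iM v).
Proof. by split=> [k a b | p a]; [rewrite !in_linE | apply: homog_inM]. Qed.
Lemma even_linear_inD : even_linear iD.
Proof. by split=> [k a b | p a]; [rewrite !in_linE | apply: homog_inD]. Qed.

Lemma even_linear_scale (U W : superspace K) k (f : U -> W) :
  even_linear f -> even_linear (fun u => k *: f u).
Proof.
move=> [lin_f even_f]; split=> [l u u' | p u hu]; last exact/homogZ/even_f.
by rewrite lin_f; module_eq.
Qed.

(** The structure maps are read off from the brackets of a few basis vectors of sl_2
    and V.  Their symmetry comes from the antisymmetry of the bracket: the
    equivariant maps to which ang and star, respectively dot and par, are
    attached are symmetric, respectively antisymmetric. *)
Lemma maps_of_short (brD : D -> D -> D) (br : G -> G -> G) :
    even_bilinear br -> (forall d d', br (iD d) (iD d') = iD (brD d d')) ->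
    short_sl2_lie_superalgebra br (@short_act K J M D) ->
  exists (actJ : D -> J -> J) (actM : D -> M -> M)
         (dot : J -> J -> J) (bul : J -> M -> M) (par : M -> M -> D)
         (ang : J -> J -> D) (star : M -> M -> J),
    [/\ even_bilinear actJ /\ even_bilinear actM,
        [/\ even_bilinear dot, even_bilinear bul, even_bilinear par,
            even_bilinear ang & even_bilinear star],
        [/\ super_symmetric dot, super_symmetric par,
            super_antisymmetric ang & super_antisymmetric star],
        describes_bracket actJ actM dot bul par ang star br &
        structure_identities brD actJ actM dot bul par ang star].
Proof.
move=> bil_br br_DD [[[_ brC jac] _ _ act_br] _].
have eJ := even_linear_inJ; have eM := even_linear_inM; have eD := even_linear_inD.
have eprE := @even_linear_prE K J M D; have eprH := @even_linear_prH K J M D.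
have eprV := @even_linear_prV K J M D; have eprD := @even_linear_prD K J M D.
pose actJ d a := prE (br (iD d) (iJ (sl2_e K) a)).
pose actM d m := prV (br (iD d) (iM (e1 K) m)).
pose dot a b := prH (br (iJ (sl2_e K) a) (iJ (sl2_f K) b)).
pose bul a m := prV (br (iJ (sl2_h K) a) (iM (e1 K) m)).
pose par m n := prD (br (iM (e1 K) m) (iM (e2 K) n)).
pose ang a b := 2^-1 *: prD (br (iJ (sl2_e K) a) (iJ (sl2_f K) b)).
pose star m n := prE (br (iM (e1 K) m) (iM (e1 K) n)).
have bil_actJ : even_bilinear actJ := even_bilinear_comp bil_br eD (eJ _) eprE.
have bil_actM : even_bilinear actM := even_bilinear_comp bil_br eD (eM _) eprV.
have bil_dot : even_bilinear dot := even_bilinear_comp bil_br (eJ _) (eJ _) eprH.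
have bil_bul : even_bilinear bul := even_bilinear_comp bil_br (eJ _) (eM _) eprV.
have bil_par : even_bilinear par := even_bilinear_comp bil_br (eM _) (eM _) eprD.
have bil_ang : even_bilinear ang :=
  even_bilinear_comp bil_br (eJ _) (eJ _) (even_linear_scale _ eprD).
have bil_star : even_bilinear star := even_bilinear_comp bil_br (eM _) (eM _) eprE.
have desc : describes_bracket actJ actM dot bul par ang star br.
  split=> //; split=> [d x hx a | d v m | x y hx hy a b | x hx v a m | v w m n].
  - exact: (br_DJ char0 bil_br.1 act_br).
  - exact: (br_DM char0 bil_br.1 act_br).
  - exact: (br_JJ char0 bil_br.1 act_br).
  - exact: (br_JM char0 bil_br.1 act_br).
  - exact: (br_MM char0 bil_br.1 act_br).
have [he hf] : sl2_e K \in sl2 K /\ sl2_f K \in sl2 K by rewrite !sl2E.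
have symJ p q a b : homog p a -> homog q b ->
    dot a b = (-1) ^+ (p * q) *: dot b a /\ ang a b = - ((-1) ^+ (p * q) *: ang b a).
  move=> ha hb; have := brC _ _ _ _ (homog_inJ M D (sl2_e K) ha) (homog_inJ M D (sl2_f K) hb).
  rewrite !(br_inJJ desc) // !sl2_brE.
  rewrite (half_killingC _ (sl2_e K)) half_killingE // => E.
  have nz1 : (1 : K) != 0 := oner_neq0 K.
  have [] := @inJ_inD_eq0 K J M D 1 2 (dot a b - (-1) ^+ (p * q) *: dot b a)
    (ang a b + (-1) ^+ (p * q) *: ang b a) nz1 (char0 1).
    by apply: (eq_scaled (k := 1)) E _; rewrite !in_linE; short_eq.
  by move=> /subr0_eq -> /eqP; rewrite addr_eq0 => /eqP ->.
have symM p q m n : homog p m -> homog q n ->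
    par m n = (-1) ^+ (p * q) *: par n m /\ star m n = - ((-1) ^+ (p * q) *: star n m).
  move=> hm hn; have := brC _ _ _ _ (homog_inM J D (e1 K) hm) (homog_inM J D (e2 K) hn).
  rewrite !(br_inMM desc) (odotVC char0 (e2 K)) !odotVE_basis // !det_formE_basis => E.
  have nz1 : (1 : K) != 0 := oner_neq0 K.
  have nzh : - 2^-1 != 0 :> K by rewrite oppr_eq0 invr_eq0; apply: (char0 1).
  have [] := @inJ_inD_eq0 K J M D (- 2^-1) 1 (star m n + (-1) ^+ (p * q) *: star n m)
    (par m n - (-1) ^+ (p * q) *: par n m) nzh nz1.
    by apply: (eq_scaled (k := 1)) E _; rewrite !in_linE; short_eq.
  by move=> /eqP; rewrite addr_eq0 => /eqP -> /subr0_eq ->.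
have dotC : super_symmetric dot by move=> p q a b ha hb; case: (symJ p q a b ha hb).
have angC : super_antisymmetric ang by move=> p q a b ha hb; case: (symJ p q a b ha hb).
have parC : super_symmetric par by move=> p q m n hm hn; case: (symM p q m n hm hn).
have starC : super_antisymmetric star by move=> p q m n hm hn; case: (symM p q m n hm hn).
exists actJ, actM, dot, bul, par, ang, star; split=> //.
move/(super_jacobiP bil_br): jac => jac.
exact: (identities_of_jacobi char0 bil_br br_DD bil_actJ bil_actM bil_dot bil_bul
  bil_par bil_ang bil_star dotC parC angC starC desc jac).
Qed.

End Maps.

Theorem theorem2p1 (R : realType) (J M D : superspace R[i])
    (brD : D -> D -> D) (HbrD : lie_superalgebra brD)
    (br : short_form J M D -> short_form J M D -> short_form J M D)
    (Hbr : even_bilinear br)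
    (Hext : forall d1 d2 : D,
       br (inD J M d1) (inD J M d2) = inD J M (brD d1 d2)) :
  short_sl2_lie_superalgebra br (@short_act _ J M D)
  <->
  exists (actJ : D -> J -> J) (actM : D -> M -> M)
         (dot : J -> J -> J) (bul : J -> M -> M) (par : M -> M -> D)
         (ang : J -> J -> D) (star : M -> M -> J),
    [/\ even_bilinear actJ /\ even_bilinear actM,
        [/\ even_bilinear dot, even_bilinear bul, even_bilinear par,
            even_bilinear ang & even_bilinear star],
        [/\ super_symmetric dot, super_symmetric par,
            super_antisymmetric ang & super_antisymmetric star],
        describes_bracket actJ actM dot bul par ang star br &
        [/\ jordan_superalgebra dot,
            special_jordan_supermodule dot bul,
            super_derives actJ actM dot bul star /\ D_acts brD actJ actM,
            [/\ D_equivariance brD actJ actM par ang,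
                ang_identities actJ actM dot bul par ang star,
                par_identities actJ actM bul par star &
                acts_by_inner_derivations actJ dot ang] &
            compatibility dot bul star]].
Proof.
have char0 (n : nat) : (n.+1%:R : R[i]) != 0 by rewrite Num.Theory.pnatr_eq0.
split; first exact: maps_of_short.
move=> [actJ [actM [dot [bul [par [ang [star]]]]]]].
move=> [[_ bM] [bd bb bp ba bs] [dC pC aC sC] desc ids].
case: HbrD => _ _ jacD.
exact: (short_of_identities char0 Hbr Hext bM bd bb bp ba bs dC pC aC sC desc jacD ids).
Qed.
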